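(* Let $e_2=(0,1,0)\in\mathbb C^3$. Then $\hat\gamma^{(2)}_{\mathbb G_3}(0;e_2)>\gamma_{\mathbb G_3}(0;e_2)$. In particular, $\hat\kappa_{\mathbb G_3}(0;e_2)>\gamma_{\mathbb G_3}(0;e_2)$ and consequently $k_{\mathbb G_3}(0,\cdot)\neq c_{\mathbb G_3}(0,\cdot)$.
   Context: Let $\mathbb D$ be the open unit disc. $\mathbb G_3=\{(a+b+c,\ ab+bc+ca,\ abc):a,b,c\in\mathbb D\}\subset\mathbb C^3$ is the symmetrized tridisc. For a domain $D\subset\mathbb C^n$, $z\in D$, $X\in\mathbb C^n$: - $\gamma_D(z;X)=\sup\{|f'(z)X|:f\in\mathcal O(D,\mathbb D),\ f(z)=0\}$ is the Carathéodory metric; - for $k\in\mathbb N$ the $k$-th Carathéodory pseudometric is $\gamma^{(k)}_D(z;X)=\sup\{|f_z^{(k)}(X)|^{1/k}:f\in\mathcal O(D,\mathbb D),\ \mathrm{ord}_zf\ge k\}$, where $f_z^{(k)}(X)=\sum_{|\alpha|=k}\frac{D^\alpha f(z)X^\alpha}{\alpha!}$ and $\mathrm{ord}_zf$ is the order of vanishing of $f$ at $z$; $\hat\gamma_D^{(k)}(z;\cdot)$ is the largest pseudonorm not exceeding $\gamma_D^{(k)}(z;\cdot)$; - $\kappa_D(z;X)=\inf\{|\alpha|:\exists f\in\mathcal O(\mathbb D,D),\ f(0)=z,\ \alpha f'(0)=X\}$ is the Kobayashi metric and $\hat\kappa_D(z;\cdot)$ (Kobayashi--Buseman metric) is the largest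 pseudonorm not exceeding $\kappa_D(z;\cdot)$; - $c_D(z,w)=\sup\{p_{\mathbb D}(f(z),f(w)):f\in\mathcal O(D,\mathbb D)\}$ is the Carathéodory (pseudo)distance, where $p_{\mathbb D}(a,b)=\tanh^{-1}\left|\frac{a-b}{1-\overline ab}\right|$; - $k_D$ is the Kobayashi (pseudo)distance, the largest pseudodistance not exceeding $\tanh^{-1}l_D$, where $l_D(z,w)=\inf\{|\alpha|:\exists f\in\mathcal O(\mathbb D,D),\ f(0)=z,\ f(\alpha)=w\}$. *)

(* Defs.v *)
From HB Require Import structures.
From mathcomp Require Import all_boot all_order all_algebra.
From mathcomp Require Import all_classical all_reals all_analysis.
From mathcomp.real_closed Require Import complex.

Set Implicit Arguments.
Unset Strict Implicit.
Unset Printing Implicit Defensive.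

Import Order.TTheory GRing.Theory Num.Theory.
Import numFieldNormedType.Exports.

Local Open Scope classical_set_scope.
Local Open Scope ring_scope.
Local Open Scope complex_scope.

(* The complex line as a normed space over itself, so that [differentiable],
   ['d], ['D_v] and [derive1] below are complex derivatives. *)
HB.instance Definition _ (R : rcfType) := NormedModule.copy R[i] R[i]^o.

Notation normc := ComplexField.Normc.normc.

Section InvariantMetrics.
Context {R : realType}.
Local Notation C := R[i].

Definition unit_disc : set C := [set z | normc z < 1].

(* O(A, B), for A open. Functions are total in Rocq; only the values on A are
   constrained. *)
Definition holo (U V : normedModType C) (A : set U) (B : set V) : set (U -> V) :=
  [set f | forall z, A z -> differentiable f z /\ B (f z)].

Definition vec3 (x y z : C) : 'rV[C]_3 := \row_(j < 3) [:: x; y; z]`_j.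

Definition symm_tridisc : set 'rV[C]_3 :=
  [set s | exists a b c, [/\ unit_disc a, unit_disc b, unit_disc c &
     s = vec3 (a + b + c) (a * b + b * c + c * a) (a * b * c)]].

Section Domain.
Context {n : nat}.
Implicit Types (D : set 'rV[C]_n) (z w X : 'rV[C]_n) (f : 'rV[C]_n -> C).

Definition caratheodory_metric D z X : \bar R :=
  ereal_sup [set (normc ('d f z X))%:E |
             f in [set f | holo D unit_disc f /\ f z = 0]].

(* The iterated partial derivative D^a f for the multi-index a. *)
Definition mpartial (a : 'I_n -> nat) f : 'rV[C]_n -> C :=
  foldr (fun i g => iter (a i) (fun h x => 'D_(delta_mx 0 i) h x) g) f
        (enum 'I_n).

(* ord_z f >= k *)
Definition ord_ge z f (k : nat) : Prop :=
  forall a : 'I_n -> nat, (\sum_i a i < k)%N -> mpartial a f z = 0.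

(* f_z^(k)(X). The multi-indices with |a| = k have all entries at most k, so
   they range over a finite type. *)
Definition taylor_form (k : nat) f z X : C :=
  \sum_(a : {ffun 'I_n -> 'I_k.+1} | (\sum_i a i)%N == k)
    mpartial (fun i => a i) f z * (\prod_i X 0 i ^+ a i) / (\prod_i (a i)`!)%:R.

(* Meaningful for k >= 1. *)
Definition caratheodory_metric_k (k : nat) D z X : \bar R :=
  ereal_sup [set (normc (taylor_form k f z X) `^ (k%:R)^-1)%:E |
             f in [set f | holo D unit_disc f /\ ord_ge z f k]].

Definition kobayashi_metric D z X : \bar R :=
  ereal_inf [set (normc a)%:E | a in [set a : C | exists f : C -> 'rV[C]_n,
             [/\ holo unit_disc D f, f 0 = z & a *: derive1 f 0 = X]]].

Definition pseudonorm (q : 'rV[C]_n -> R) : Prop :=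
  (forall X Y, q (X + Y) <= q X + q Y) /\
  (forall (a : C) X, q (a *: X) = normc a * q X).

(* The largest pseudonorm not exceeding g; see pseudonorm_hull_max. *)
Definition pseudonorm_hull (g : 'rV[C]_n -> \bar R) X : \bar R :=
  ereal_sup [set (q X)%:E |
             q in [set q | pseudonorm q /\ forall Y, ((q Y)%:E <= g Y)%E]].

Definition caratheodory_metric_k_hat (k : nat) D z : 'rV[C]_n -> \bar R :=
  pseudonorm_hull (caratheodory_metric_k k D z).

Definition kobayashi_buseman_metric D z : 'rV[C]_n -> \bar R :=
  pseudonorm_hull (kobayashi_metric D z).

Definition artanh (x : R) : R := ln ((1 + x) / (1 - x)) / 2.

Definition poincare_dist (a b : C) : R :=
  artanh (normc ((a - b) / (1 - conjc a * b))).

Definition caratheodory_dist D z w : \bar R :=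
  ereal_sup [set (poincare_dist (f z) (f w))%:E | f in holo D unit_disc].

Definition lempert D z w : \bar R :=
  ereal_inf [set (normc a)%:E | a in [set a : C | unit_disc a /\
             exists f : C -> 'rV[C]_n,
               [/\ holo unit_disc D f, f 0 = z & f a = w]]].

(* tanh^-1 on [0, +oo], equal to +oo from 1 on. *)
Definition artanhe (x : \bar R) : \bar R :=
  if (x < 1)%E then (artanh (fine x))%:E else +oo%E.

Definition pseudodistance_on D (d : 'rV[C]_n -> 'rV[C]_n -> R) : Prop :=
  [/\ forall x, D x -> d x x = 0,
      forall x y, D x -> D y -> d x y = d y x &
      forall x y t, D x -> D y -> D t -> d x t <= d x y + d y t].

(* The largest pseudodistance on D not exceeding g; see
   pseudodistance_hull_max. *)
Definition pseudodistance_hull D (g : 'rV[C]_n -> 'rV[C]_n -> \bar R) z w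
    : \bar R :=
  ereal_sup [set (d z w)%:E | d in [set d | pseudodistance_on D d /\
             forall x y, D x -> D y -> ((d x y)%:E <= g x y)%E]].

Definition kobayashi_dist D : 'rV[C]_n -> 'rV[C]_n -> \bar R :=
  pseudodistance_hull D (fun x y => artanhe (lempert D x y)).

Lemma normc_ge0 (a : C) : 0 <= normc a.
Proof. by case: a => x y; rewrite sqrtr_ge0. Qed.

Lemma pseudonorm_hull_max (g : 'rV[C]_n -> \bar R) :
  (forall X, (0 <= g X < +oo)%E) ->
  exists q : 'rV[C]_n -> R,
    [/\ forall X, pseudonorm_hull g X = (q X)%:E, pseudonorm q,
        forall X, ((q X)%:E <= g X)%E &
        forall p, pseudonorm p -> (forall X, ((p X)%:E <= g X)%E) ->
          forall X, p X <= q X].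
Proof.
move=> g_fin; have hg X : (pseudonorm_hull g X <= g X)%E.
  by apply: ge_ereal_sup => _ [q [_ qg] <-].
have ph p : pseudonorm p -> (forall X, ((p X)%:E <= g X)%E) ->
    forall X, ((p X)%:E <= pseudonorm_hull g X)%E.
  by move=> pp pg X; apply: ereal_sup_ubound; exists p.
have p0 : pseudonorm (fun=> 0) by split=> *; rewrite ?addr0 ?mulr0.
have h0 X : (0 <= pseudonorm_hull g X)%E.
  by apply: (ph (fun=> 0)) => // Y; case/andP: (g_fin Y).
have hfin X : pseudonorm_hull g X \is a fin_num.
  rewrite ge0_fin_numE//; apply: le_lt_trans (hg X) _.
  by case/andP: (g_fin X).
pose q X := fine (pseudonorm_hull g X).
have hq X : pseudonorm_hull g X = (q X)%:E by rewrite fineK.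
have qD X Y : q (X + Y) <= q X + q Y.
  rewrite -lee_fin -hq; apply: ge_ereal_sup => _ [p [pp pg] <-].
  rewrite lee_fin (le_trans (pp.1 X Y))//.
  by apply: lerD; rewrite -lee_fin -hq ph.
have qZ_le (a : C) X : q (a *: X) <= normc a * q X.
  rewrite -lee_fin -hq; apply: ge_ereal_sup => _ [p [pp pg] <-].
  rewrite lee_fin pp.2; apply: ler_wpM2l; first exact: normc_ge0.
  by rewrite -lee_fin -hq ph.
exists q; split=> //; last 2 first.
- by move=> X; rewrite -hq.
- by move=> p pp pg X; rewrite -lee_fin -hq ph.
split=> // a X; apply/eqP; rewrite eq_le qZ_le /=.
rewrite -lee_fin -hq.
have [->|a0] := eqVneq a 0.
  by rewrite ComplexField.Normc.normc0 mul0r h0.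
have na : 0 < normc a.
  rewrite lt_neqAle normc_ge0 andbT eq_sym; apply: contra a0.
  by move=> /eqP/ComplexField.Normc.eq0_normc ->.
rewrite hq lee_fin -ler_pdivlMl//.
rewrite -[X in q X <= _](scalerK a0).
by rewrite -ComplexField.Normc.normcV qZ_le.
Qed.

Lemma pseudodistance_hull_max D (g : 'rV[C]_n -> 'rV[C]_n -> \bar R) :
  (forall x y, D x -> D y -> (0 <= g x y < +oo)%E) ->
  exists d : 'rV[C]_n -> 'rV[C]_n -> R,
    [/\ forall x y, D x -> D y -> pseudodistance_hull D g x y = (d x y)%:E,
        pseudodistance_on D d,
        forall x y, D x -> D y -> ((d x y)%:E <= g x y)%E &
        forall e, pseudodistance_on D e ->
          (forall x y, D x -> D y -> ((e x y)%:E <= g x y)%E) ->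
          forall x y, D x -> D y -> e x y <= d x y].
Proof.
move=> g_fin; set h := pseudodistance_hull D g.
have hg x y : D x -> D y -> (h x y <= g x y)%E.
  by move=> Dx Dy; apply: ge_ereal_sup => _ [e [_ eg] <-]; exact: eg.
have eh e : pseudodistance_on D e ->
    (forall x y, D x -> D y -> ((e x y)%:E <= g x y)%E) ->
    forall x y, ((e x y)%:E <= h x y)%E.
  by move=> pe eg x y; apply: ereal_sup_ubound; exists e.
have h0 x y : (0 <= h x y)%E.
  apply: (eh (fun _ _ => 0)); first by split=> *; rewrite ?addr0.
  by move=> a b Da Db; case/andP: (g_fin a b Da Db).
pose d x y := fine (h x y).
have hd x y : D x -> D y -> h x y = (d x y)%:E.
  move=> Dx Dy; rewrite fineK// ge0_fin_numE//.
  by apply: le_lt_trans (hg x y Dx Dy) _; case/andP: (g_fin x y Dx Dy).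
exists d; split=> //; last 2 first.
- by move=> x y Dx Dy; rewrite -hd// hg.
- by move=> e pe eg x y Dx Dy; rewrite -lee_fin -hd// eh.
have sym x y : D x -> D y -> d x y <= d y x.
  move=> Dx Dy; rewrite -lee_fin -!hd//.
  apply: ge_ereal_sup => _ [e [pe eg] <-].
  by case: (pe) => _ es _; rewrite es// eh.
split.
- move=> x Dx; apply/eqP; rewrite eq_le -!lee_fin -!hd// h0 andbT.
  by apply: ge_ereal_sup => _ [e [[e0 _ _] _] <-]; rewrite e0.
- by move=> x y Dx Dy; apply/eqP; rewrite eq_le !sym.
- move=> x y t Dx Dy Dt; rewrite -lee_fin -hd//.
  apply: ge_ereal_sup => _ [e [pe eg] <-].
  case: (pe) => _ _ et; rewrite lee_fin (le_trans (et x y t _ _ _))//.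
  by apply: lerD; rewrite -lee_fin -hd// eh.
Qed.

End Domain.
End InvariantMetrics.

(* Main.v *)
Require Import Defs.
From mathcomp Require Import all_boot all_order all_algebra.
From mathcomp Require Import all_classical all_reals all_analysis.
From mathcomp.real_closed Require Import complex.
From mathcomp Require Import ring lra.

(** Composing a function on the symmetrized tridisc with a triple of roots
    turns it into a symmetric function on the tridisc; write s1, s2, s3 for the
    elementary symmetric functions.

    Upper bound for the Caratheodory metric.  Let f map the symmetrized tridisc to
    the unit disc, and take two triples with the same s1.  Along the curves
    l |-> (l s1, l^2 s2, l^3 s3) the second-order coefficient of f is
    f'(0)e2 * s2 plus a term which depends on s1 only, so that it cancels in the
    difference of the two curves; the difference is bounded by 2, whence
    |f'(0)e2| |s2 - s2'| <= 2 ([derivative_e2_bound]).  A triple and its complex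
    conjugate, chosen near the optimum, give |f'(0)e2| <= 0.8212.

    Lower bound for the second metric.  The polynomial
    s2^2 + B s1^2 s2 + C s1^4 does better than the square of any
    s2 + c s1^2: for suitable B and C its modulus is at most 37/25 on the
    torus, hence on the tridisc ([quartic_tridisc]).  On the torus
    s2 = s3 * conj s1, so that the modulus depends on the point of a deltoid
    only, and the bound reduces to polynomial inequalities in one real
    variable ([deltoid_bound]).  As the quadratic part of this polynomial in
    the coordinates of C^3 is X2^2, the pseudonorm sqrt(27/40) |X2| is below
    the second Caratheodory pseudometric; and composing the polynomial with an
    analytic disc puts it below the Kobayashi metric.  Since
    sqrt(27/40) > 0.8214 > 0.8212, the two inequalities between metrics follow.

    Distances.  The bound on the speed of analytic discs persists for discs
    centred near 0 ([disc_speed_bound]).  Hence a tent function, with slope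
    0.8214 in the direction e2 and support close to 0, is a contraction for the
    Lempert function ([tent_le_artanh_lempert]); it bounds the Kobayashi
    distance from 0 to (0,t,0) below by 0.8214 t, while the Caratheodory
    distance is at most 0.8212 t + O(t^2).

    All estimates for holomorphic functions come from Cauchy's inequality for
    the first nonzero Taylor coefficient ([taylor_coef_bound]).  It rests on
    Goursat's lemma for Riemann sums over the boundary of a parallelogram
    ([goursat]), applied to f(exp w) / exp(n w) on a rectangle of height
    2 pi, whose horizontal sides cancel by periodicity. *)

Set Implicit Arguments.
Unset Strict Implicit.
Unset Printing Implicit Defensive.

Import Order.TTheory GRing.Theory Num.Theory.
Import numFieldNormedType.Exports.
Import ComplexField.Normc.

Local Open Scope classical_set_scope.
Local Open Scope ring_scope.
Local Open Scope complex_scope.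

(** * Dyadic subdivision of the unit square *)

Section Cousin.
Context {R : realType}.

Lemma dyadic_nested (a : nat -> R) :
  (forall j, a j <= a j.+1 <= a j + (2 ^+ j.+1)^-1) ->
  exists p, forall j, a j <= p <= a j + (2 ^+ j)^-1.
Proof.
move=> ha.
have e2 j : (2 ^+ j : R)^-1 = (2 ^+ j.+1)^-1 + (2 ^+ j.+1)^-1.
  by rewrite exprS invfM; field; rewrite expf_neq0.
have up k j : a j <= a (j + k)%N /\ a (j + k)%N + (2 ^+ (j + k))^-1 <= a j + (2 ^+ j)^-1.
  elim: k => [|k [IH1 IH2]]; first by rewrite addn0.
  have /andP[h1 h2] := ha (j + k)%N; have := e2 (j + k)%N.
  by rewrite addnS; split; lra.
have cross i j : a i <= a j + (2 ^+ j)^-1.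
  have p k : 0 < (2 ^+ k : R)^-1 by rewrite invr_gt0 exprn_gt0.
  have [ij|/ltnW ji] := leqP i j.
    have [+ _] := up (j - i)%N i; rewrite subnKC// => h; have := p j; lra.
  have [_ ] := up (i - j)%N j; rewrite subnKC// => h; have := p i; lra.
have hs : has_sup (range a).
  by split; [exists (a 0%N); exists 0%N|exists (a 0%N + (2 ^+ 0)^-1) => _ [i _ <-]].
exists (sup (range a)) => j; apply/andP; split.
  by apply: ub_le_sup; [exact: hs.2|exists j].
by apply: ge_sup; [exact: hs.1|move=> _ [i _ <-]].
Qed.

(** Cousin's lemma by bisection: a property of dyadic squares that passes
    from the four quarters to the whole, and holds for small squares around
    every point, holds for the unit square.  Otherwise a nested sequence of
    bad squares would shrink to a point. *)
Lemma dyadic_cousin (P : R -> R -> nat -> Prop) :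
  (forall s t j (d := (2 ^+ j.+1)^-1), P s t j.+1 -> P (s + d) t j.+1 ->
     P s (t + d) j.+1 -> P (s + d) (t + d) j.+1 -> P s t j) ->
  (forall p q, 0 <= p <= 1 -> 0 <= q <= 1 -> exists J, forall j s t,
     (J <= j)%N -> s <= p <= s + (2 ^+ j)^-1 -> t <= q <= t + (2 ^+ j)^-1 ->
     P s t j) ->
  P 0 0 0%N.
Proof.
move=> glue loc; apply: contrapT => nP.
pose d j : R := (2 ^+ j.+1)^-1.
have d0 j : 0 <= d j by rewrite invr_ge0 exprn_ge0.
have child (u : R * R) j : exists v : R * R,
    (v.1 = u.1 \/ v.1 = u.1 + d j) /\ (v.2 = u.2 \/ v.2 = u.2 + d j) /\
    (~ P u.1 u.2 j -> ~ P v.1 v.2 j.+1).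
  have [Pu|nPu] := EM (P u.1 u.2 j).
    by exists u; split; [left|split; [left|]].
  apply: contrapT => H; apply: nPu; apply: glue; apply: contrapT => nQ; apply: H.
  - by exists (u.1, u.2); split; [left|split; [left|]].
  - by exists (u.1 + d j, u.2); split; [right|split; [left|]].
  - by exists (u.1, u.2 + d j); split; [left|split; [right|]].
  - by exists (u.1 + d j, u.2 + d j); split; [right|split; [right|]].
pose nx u j := sval (cid (child u j)).
pose st := fix st j := if j is j'.+1 then nx (st j') j' else (0, 0).
have stP j : [/\ (st j).1 <= (st j.+1).1 <= (st j).1 + d j,
    (st j).2 <= (st j.+1).2 <= (st j).2 + d j & ~ P (st j).1 (st j).2 j].
  elim: j => [|j [_ _ IH]].
    have [h1 [h2 _]] := svalP (cid (child (st 0%N) 0%N)).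
    have := d0 0%N; split=> //=.
      by case: h1 => /= ->; rewrite ?lexx ?lerDl ?d0.
    by case: h2 => /= ->; rewrite ?lexx ?lerDl ?d0.
  have [_ [_ /(_ IH) hn]] := svalP (cid (child (st j) j)).
  have [h1 [h2 _]] := svalP (cid (child (st j.+1) j.+1)).
  split=> //.
    by case: h1 => /= ->; rewrite ?lexx ?lerDl ?d0.
  by case: h2 => /= ->; rewrite ?lexx ?lerDl ?d0.
have [p hp] := @dyadic_nested (fun j => (st j).1) (fun j => let: And3 h _ _ := stP j in h).
have [q hq] := @dyadic_nested (fun j => (st j).2) (fun j => let: And3 _ h _ := stP j in h).
have hp0 : 0 <= p <= 1 by have := hp 0%N; rewrite /= expr0 invr1 add0r.
have hq0 : 0 <= q <= 1 by have := hq 0%N; rewrite /= expr0 invr1 add0r.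
have [J HJ] := loc p q hp0 hq0.
by have [_ _] := stP J; apply; apply: HJ.
Qed.

End Cousin.

(** * The modulus of complex numbers *)

Section Norm.
Context {R : realType}.
Local Notation C := R[i].
Implicit Types (z w : C) (a : R).

Lemma complex_normE z : `|z| = (normc z)%:C. Proof. by []. Qed.

Lemma normcD_le z w : normc (z + w) <= normc z + normc w.
Proof. exact: le_normcD. Qed.

Lemma normc_opp z : normc (- z) = normc z. Proof. exact: normcN. Qed.

Lemma normcB_le z w : normc (z - w) <= normc z + normc w.
Proof. by rewrite -(normc_opp w); exact: normcD_le. Qed.

Lemma normc_real a : normc a%:C = `|a|.
Proof. by rewrite /normc /= expr0n addr0 sqrtr_sqr. Qed.

Lemma normcX z n : normc (z ^+ n) = normc z ^+ n.
Proof. by elim: n => [|n IH]; rewrite ?normc1// !exprS normcM IH. Qed.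

Lemma normc_dist z w : normc (z - w) = normc (w - z).
Proof. by rewrite -normc_opp opprB. Qed.

Lemma normc_sum n (F : 'I_n -> C) : normc (\sum_i F i) <= \sum_i normc (F i).
Proof.
elim/big_ind2: _ => [|x1 x2 y1 y2 h1 h2|//]; first by rewrite normc0.
exact: le_trans (normcD_le _ _) (lerD h1 h2).
Qed.

Lemma normc_nat n : normc (n%:R : C) = n%:R.
Proof. by rewrite -[n%:R in LHS](rmorph_nat (real_complex R)) normc_real ger0_norm. Qed.

Lemma normc2 : normc (2 : C) = 2. Proof. exact: normc_nat. Qed.

Lemma normc_le_parts (a b : R) : normc (a +i* b) <= `|a| + `|b|.
Proof.
rewrite /normc -[leRHS]ger0_norm ?addr_ge0// -sqrtr_sqr ler_wsqrtr//.
rewrite sqrrD !real_normK ?num_real//.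
have : 0 <= `|a| * `|b| by rewrite mulr_ge0.
by lra.
Qed.

Lemma Re_le_normc (z : C) : `|complex.Re z| <= normc z.
Proof. by rewrite -lecR; exact: normc_ge_Re. Qed.

Lemma Im_le_normc (z : C) : `|complex.Im z| <= normc z.
Proof.
case: z => a b /=; rewrite -[leLHS]sqrtr_sqr ler_wsqrtr//.
by rewrite lerDr sqr_ge0.
Qed.

Lemma normc_sqr_conj z : (normc z ^+ 2)%:C = z * conjc z.
Proof.
case: z => a b; rewrite /normc sqr_sqrtr ?addr_ge0 ?sqr_ge0//.
by apply/eqP; rewrite eq_complex /=; apply/andP; split; apply/eqP; ring.
Qed.

Lemma normc_conj z : normc (conjc z) = normc z.
Proof. by case: z => a b; rewrite /normc /= sqrrN. Qed.

Lemma conjcM (z w : C) : conjc (z * w) = conjc z * conjc w.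
Proof. exact: rmorphM. Qed.

Lemma conjcD (z w : C) : conjc (z + w) = conjc z + conjc w.
Proof. exact: rmorphD. Qed.

Lemma conjcX (z : C) n : conjc (z ^+ n) = conjc z ^+ n.
Proof. exact: rmorphXn. Qed.

Lemma rcD (x y : R) : (x + y)%:C = x%:C + y%:C. Proof. exact: rmorphD. Qed.
Lemma rcB (x y : R) : (x - y)%:C = x%:C - y%:C. Proof. exact: rmorphB. Qed.
Lemma rcM (x y : R) : (x * y)%:C = x%:C * y%:C. Proof. exact: rmorphM. Qed.
Lemma rcX (x : R) n : (x ^+ n)%:C = x%:C ^+ n. Proof. exact: rmorphXn. Qed.
Lemma rc_nat n : (n%:R : R)%:C = n%:R. Proof. exact: rmorph_nat. Qed.

End Norm.

(** * Goursat's lemma for Riemann sums *)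

Section Goursat.
Context {R : realType}.
Local Notation C := R[i].
Implicit Types (F : C -> C) (w v : C) (N m : nat).

(** The one-dimensional case of Cousin's lemma: the second coordinate of
    the dyadic squares is ignored. *)
Lemma mean_value_ineq (phi : R -> C) (K : R) :
  (forall t, 0 <= t <= 1 -> exists2 d, 0 < d & forall s, `|s - t| < d ->
     normc (phi s - phi t) <= K * `|s - t|) ->
  normc (phi 1 - phi 0) <= K.
Proof.
move=> loc.
pose P (s t : R) j := normc (phi (s + (2 ^+ j)^-1) - phi s) <= K * (2 ^+ j)^-1.
suff : P 0 0 0%N by rewrite /P expr0 invr1 add0r mulr1.
apply: (@dyadic_cousin _ P) => [s t j d h1 h2 _ _|p q p01 _].
  have e2 : (2 ^+ j : R)^-1 = d + d.
    by rewrite /d exprS invfM; field; rewrite expf_neq0.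
  move: h1 h2; rewrite /P -/d e2 addrA => h1 h2.
  rewrite -(subrK (phi (s + d)) (phi (s + d + d))) -addrA.
  rewrite (le_trans (normcD_le _ _))//; lra.
have [d d0 hd] := loc p p01.
have [J hJ] : exists J, (2 ^+ J : R)^-1 < d.
  exists (Num.truncn d^-1).+1; rewrite invf_plt ?posrE ?exprn_gt0//.
  apply: lt_le_trans (truncnS_gt d^-1) _.
  by rewrite -natrX ler_nat ltnW// ltn_expl.
exists J => j s t Jj /andP[sp ps] _; rewrite /P.
have jJ : (2 ^+ j : R)^-1 <= (2 ^+ J)^-1.
  by rewrite lef_pV2 ?posrE ?exprn_gt0// ler_eXn2l// ltr1n.
set e := (2 ^+ j)^-1 in ps jJ *.
have tri := normcB_le (phi (s + e) - phi p) (phi s - phi p).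
rewrite (_ : _ - _ - _ = phi (s + e) - phi s) in tri; last by ring.
have := hd (s + e); have := hd s.
have -> : `|s - p| = p - s by rewrite ler0_norm; lra.
have -> : `|s + e - p| = s + e - p by rewrite ger0_norm; lra.
move=> h1 h2; have := h1 ltac:(lra); have := h2 ltac:(lra); lra.
Qed.

(** Left Riemann sum, with [N] equal steps, of the mean of [F] on the
    segment from [w] to [w + v]. *)
Definition edge_mean F w v N := (\sum_(k < N) F (w + (k%:R / N%:R) * v)) / N%:R.

(** Riemann sum of the contour integral of [F] around the parallelogram with
    corner [w] and sides [v1], [v2], traversed as
    w, w + v1, w + v1 + v2, w + v2. *)
Definition boundary_sum m F w v1 v2 : C :=
  v1 * edge_mean F w v1 (2 ^ m) + v2 * edge_mean F (w + v1) v2 (2 ^ m)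
  - v1 * edge_mean F (w + v2) v1 (2 ^ m) - v2 * edge_mean F w v2 (2 ^ m).

Lemma edge_mean_halves F w v N : (0 < N)%N ->
  edge_mean F w v (N + N) = (edge_mean F w (v / 2) N + edge_mean F (w + v / 2) (v / 2) N) / 2.
Proof.
move=> N0; have N0' : N%:R != 0 :> C by rewrite pnatr_eq0 -lt0n.
have NN0' : (N + N)%:R != 0 :> C by rewrite pnatr_eq0 -lt0n addn_gt0 N0.
have inv : ((N + N)%:R : C)^-1 = N%:R^-1 / 2.
  have -> : (N + N)%:R = N%:R * 2 :> C by rewrite natrD; ring.
  by rewrite invfM.
rewrite /edge_mean big_split_ord /= inv mulrA -mulrDl; congr (_ / _ / _).
congr (_ + _); apply: eq_bigr => k _; congr (F _); first by field.
have -> : (N + k)%:R = N%:R + k%:R :> C by rewrite natrD.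
by field.
Qed.

(** The interior edges of the four quarters cancel. *)
Lemma boundary_sumS m F w v1 v2 : boundary_sum m.+1 F w v1 v2 =
  boundary_sum m F w (v1 / 2) (v2 / 2) + boundary_sum m F (w + v1 / 2) (v1 / 2) (v2 / 2)
  + boundary_sum m F (w + v2 / 2) (v1 / 2) (v2 / 2)
  + boundary_sum m F (w + v1 / 2 + v2 / 2) (v1 / 2) (v2 / 2).
Proof.
rewrite /boundary_sum expnS mul2n -addnn !edge_mean_halves ?expn_gt0//.
have -> : w + v1 / 2 + v1 / 2 = w + v1 by field.
have -> : w + v2 / 2 + v2 / 2 = w + v2 by field.
have -> : w + v1 / 2 + v2 / 2 + v1 / 2 = w + v1 + v2 / 2 by field.
have -> : w + v1 / 2 + v2 / 2 + v2 / 2 = w + v2 + v1 / 2 by field.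
have -> : w + v2 / 2 + v1 / 2 = w + v1 / 2 + v2 / 2 by ring.
by field.
Qed.

Lemma edge_meanB F G w v N : edge_mean (fun z => F z - G z) w v N = edge_mean F w v N - edge_mean G w v N.
Proof. by rewrite /edge_mean sumrB mulrBl. Qed.

Lemma edge_mean_affine a b w v N : (0 < N)%N ->
  edge_mean (fun z => a + b * z) w v N =
  a + b * (w + (\sum_(k < N) (k%:R / N%:R : C)) / N%:R * v).
Proof.
move=> N0; have N0' : N%:R != 0 :> C by rewrite pnatr_eq0 -lt0n.
rewrite /edge_mean big_split /= sumr_const card_ord -mulr_sumr big_split /=.
rewrite sumr_const card_ord -mulr_suml.
by rewrite -[a *+ N]mulr_natl -[w *+ N]mulr_natl; field.
Qed.

(** Affine functions have boundary sum exactly 0, not only in the limit: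
    opposite edges are sampled at corresponding points. *)
Lemma boundary_sum_affine m F a b w v1 v2 :
  boundary_sum m F w v1 v2 = boundary_sum m (fun z => F z - (a + b * z)) w v1 v2.
Proof. by rewrite /boundary_sum !edge_meanB !edge_mean_affine ?expn_gt0//; ring. Qed.

Lemma edge_mean_le F w v N (e : R) : 0 <= e ->
  (forall s : R, 0 <= s <= 1 -> normc (F (w + s%:C * v)) <= e) ->
  normc (edge_mean F w v N) <= e.
Proof.
move=> e0 he; rewrite /edge_mean normcM normcV normc_nat.
have [->|N0] := posnP N; first by rewrite big_ord0 normc0 mul0r.
rewrite ler_pdivrMr ?ltr0n//; apply: (le_trans (normc_sum _)).
apply: (@le_trans _ _ (\sum_(i < N) e)); last first.
  by rewrite sumr_const card_ord mulr_natr.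
apply: ler_sum => k _.
have -> : k%:R / N%:R = (k%:R / N%:R : R)%:C :> C.
  by rewrite rmorphM fmorphV !rmorph_nat.
apply: he; rewrite divr_ge0//= ler_pdivrMr ?ltr0n// mul1r ler_nat.
exact/ltnW.
Qed.

(** Call a dyadic cell good when its boundary sums are eventually at most
    e / 4^j at level j.  Goodness passes from the quarters to the cell by
    [boundary_sumS]; near a point where [F] is differentiable, [F] is an affine
    function up to an error of small order, so that small cells are good.
    Working with eventual bounds instead of limits makes integrals
    unnecessary. *)
Lemma goursat F w v1 v2 :
  (forall s t : R, 0 <= s <= 1 -> 0 <= t <= 1 ->
     let p := w + s%:C * v1 + t%:C * v2 in
     exists D, forall e, 0 < e -> exists2 d, 0 < d & forall z,
       normc (z - p) < d -> normc (F z - F p - D * (z - p)) <= e * normc (z - p)) ->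
  forall e, 0 < e -> exists m0, forall m, (m0 <= m)%N ->
    normc (boundary_sum m F w v1 v2) <= e.
Proof.
move=> loc e e0; set L := normc v1 + normc v2.
have L0 : 0 <= L by rewrite addr_ge0 ?normc_ge0.
pose h j : R := (2 ^+ j)^-1.
have h0 j : 0 < h j by rewrite invr_gt0 exprn_gt0.
have hS j : h j = h j.+1 + h j.+1.
  by rewrite /h exprS invfM; field; rewrite expf_neq0.
pose cb m s t j := boundary_sum m F (w + s%:C * v1 + t%:C * v2) ((h j)%:C * v1) ((h j)%:C * v2).
pose P s t j := exists m0, forall m, (m0 <= m)%N -> normc (cb m s t j) <= e * h j ^+ 2.
suff [m0 H] : P 0 0 0%N.
  exists m0 => m /H.
  by rewrite /cb /h expr0 invr1 !mul0r !addr0 !mul1r expr1n mulr1.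
apply: (@dyadic_cousin _ P) => [s t j d [a Ha] [b Hb] [c Hc] [a' Hd]|p q p01 q01].
  exists (maxn (maxn a b) (maxn c a')).+1 => -[//|m].
  rewrite ltnS !geq_max => /andP[/andP[ma mb] /andP[mc md]].
  have hC : (h j)%:C = (h j.+1)%:C * 2 by rewrite hS rmorphD /=; ring.
  have half v : (h j)%:C * v / 2 = (h j.+1)%:C * v by rewrite hC; field.
  rewrite /cb boundary_sumS !half -/(h _).
  have -> : w + s%:C * v1 + t%:C * v2 + (h j.+1)%:C * v1 =
    w + (s + d)%:C * v1 + t%:C * v2 by rewrite rmorphD /=; ring.
  have -> : w + s%:C * v1 + t%:C * v2 + (h j.+1)%:C * v2 =
    w + s%:C * v1 + (t + d)%:C * v2 by rewrite rmorphD /=; ring.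
  have -> : w + (s + d)%:C * v1 + t%:C * v2 + (h j.+1)%:C * v2 =
    w + (s + d)%:C * v1 + (t + d)%:C * v2 by rewrite !rmorphD /=; ring.
  rewrite !(le_trans (normcD_le _ _))//.
  have := (Ha m ma, Hb m mb, Hc m mc, Hd m md).
  rewrite /cb => -[[[A1 A2] A3] A4].
  have -> : e * h j ^+ 2 = e * h j.+1 ^+ 2 + e * h j.+1 ^+ 2 + e * h j.+1 ^+ 2
    + e * h j.+1 ^+ 2 by rewrite hS; ring.
  apply: lerD A4; rewrite (le_trans (normcD_le _ _))//.
  apply: lerD A3; rewrite (le_trans (normcD_le _ _))//.
  exact: lerD.
have [D HD] := loc p q p01 q01.
set z0 := w + p%:C * v1 + q%:C * v2 in HD.
have e1 : 0 < e / (2 * (L + 1) ^+ 2).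
  by rewrite divr_gt0// mulr_gt0// exprn_gt0// ltr_wpDl.
have [d d0 hd] := HD _ e1.
have [J hJ] : exists J, h J * (L + 1) < d.
  have dL : 0 < d / (L + 1) by rewrite divr_gt0// ltr_wpDl.
  exists (Num.truncn (d / (L + 1))^-1).+1; rewrite -ltr_pdivlMr ?ltr_wpDl//.
  rewrite /h invf_plt ?posrE ?exprn_gt0//.
  apply: lt_le_trans (truncnS_gt _) _.
  by rewrite -natrX ler_nat ltnW// ltn_expl.
exists J => j s t Jj /andP[sp ps] /andP[tq qt].
have jJ : h j <= h J.
  by rewrite lef_pV2 ?posrE ?exprn_gt0// ler_eXn2l// ltr1n.
rewrite -/(h j) in ps qt.
set E := e / (2 * (L + 1) ^+ 2) * (h j * L).
have E0 : 0 <= E by apply: mulr_ge0; [exact: ltW|apply: mulr_ge0 => //; exact: ltW].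
have bnd (x y : R) : s <= x <= s + h j -> t <= y <= t + h j ->
    normc (F (w + x%:C * v1 + y%:C * v2) -
      (F z0 - D * z0 + D * (w + x%:C * v1 + y%:C * v2))) <= E.
  move=> /andP[sx xs] /andP[ty yt]; set z := w + _ + _.
  have -> : F z - (F z0 - D * z0 + D * z) = F z - F z0 - D * (z - z0) by ring.
  have nz : normc (z - z0) <= h j * L.
    have -> : z - z0 = (x - p)%:C * v1 + (y - q)%:C * v2.
      by rewrite /z /z0 !rmorphB /=; ring.
    rewrite (le_trans (normcD_le _ _))// !normcM !normc_real mulrDr.
    apply: lerD; apply: ler_wpM2r; rewrite ?normc_ge0// ler_norml; lra.
  apply: (le_trans (hd z _)).
    apply: le_lt_trans nz _; apply: le_lt_trans hJ.
    apply: (@le_trans _ _ (h J * L)); first exact: ler_wpM2r.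
    by apply: ler_wpM2l; rewrite ?ltW// ltrDl.
  by rewrite /E; apply: ler_wpM2l => //; rewrite ltW.
exists 0%N => m _.
rewrite /cb (@boundary_sum_affine _ _ (F z0 - D * z0) D) /boundary_sum.
set G := fun z => _.
have g1 y : t <= y <= t + h j ->
    normc (edge_mean G (w + s%:C * v1 + y%:C * v2) ((h j)%:C * v1) (2 ^ m)) <= E.
  move=> hy; apply: edge_mean_le => // x /andP[x0 x1].
  have -> : w + s%:C * v1 + y%:C * v2 + x%:C * ((h j)%:C * v1) =
    w + (s + x * h j)%:C * v1 + y%:C * v2 by rewrite rmorphD rmorphM /=; ring.
  apply: bnd => //; rewrite lerDl lerD2l mulr_ge0 ?(ltW (h0 _))//=.
  by rewrite ler_piMl// ltW.
have g2 x : s <= x <= s + h j ->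
    normc (edge_mean G (w + x%:C * v1 + t%:C * v2) ((h j)%:C * v2) (2 ^ m)) <= E.
  move=> hx; apply: edge_mean_le => // y /andP[y0 y1].
  have -> : w + x%:C * v1 + t%:C * v2 + y%:C * ((h j)%:C * v2) =
    w + x%:C * v1 + (t + y * h j)%:C * v2 by rewrite !rmorphD rmorphM /=; ring.
  apply: bnd => //; rewrite lerDl lerD2l mulr_ge0 ?(ltW (h0 _))//=.
  by rewrite ler_piMl// ltW.
have hin (x : R) : x <= x <= x + h j by rewrite lexx lerDl ltW.
have hin' (x : R) : x <= x + h j <= x + h j by rewrite lexx lerDl ltW.
have := g1 t (hin _); have := g1 _ (hin' t); have := g2 s (hin _); have := g2 _ (hin' s).
have -> : w + s%:C * v1 + t%:C * v2 + (h j)%:C * v1 = w + (s + h j)%:C * v1 + t%:C * v2.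
  by rewrite rmorphD /=; ring.
have -> : w + s%:C * v1 + t%:C * v2 + (h j)%:C * v2 = w + s%:C * v1 + (t + h j)%:C * v2.
  by rewrite rmorphD /=; ring.
set A2 := edge_mean _ _ _ _; set A4 := edge_mean _ _ _ _; set A3 := edge_mean _ _ _ _; set A1 := edge_mean _ _ _ _.
move=> h2 h4 h3 h1.
have nh v A : normc A <= E -> normc ((h j)%:C * v * A) <= h j * normc v * E.
  move=> hA; rewrite !normcM normc_real ger0_norm ?(ltW (h0 _))//.
  by apply: ler_wpM2l => //; rewrite mulr_ge0 ?normc_ge0// ltW.
apply: (@le_trans _ _ (h j * normc v1 * E + h j * normc v2 * E + h j * normc v1 * E + h j * normc v2 * E)).
  rewrite (le_trans (normcB_le _ _))// lerD ?nh// (le_trans (normcB_le _ _))// lerD ?nh//.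
  by rewrite (le_trans (normcD_le _ _))// lerD ?nh.
have -> : h j * normc v1 * E + h j * normc v2 * E + h j * normc v1 * E + h j * normc v2 * E
  = 2 * (h j * L) * E by rewrite /L; ring.
have -> : 2 * (h j * L) * E = e * h j ^+ 2 * (L / (L + 1)) ^+ 2.
  by rewrite /E; field; rewrite gt_eqF// ltr_wpDl.
have L1 : 0 < L + 1 by rewrite ltr_wpDl.
have q0 : 0 <= L / (L + 1) by apply: divr_ge0 => //; exact: ltW.
have q1 : L / (L + 1) <= 1 by rewrite ler_pdivrMr// mul1r lerDl.
apply: ler_piMr; last by apply: exprn_ile1.
by apply: mulr_ge0; [exact: ltW|apply: exprn_ge0; exact: ltW].
Qed.

End Goursat.

(** * Complex derivatives and the exponential *)

Section CDiff.
Context {R : realType}.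
Local Notation C := R[i].
Local Notation Re := (@complex.Re R).
Local Notation Im := (@complex.Im R).

(** Complex differentiability with the real-valued modulus, the form in
    which estimates over the reals use it. *)
Definition cdiff (f : C -> C) (p D : C) := forall e : R, 0 < e ->
  exists2 d : R, 0 < d & forall z, normc (z - p) < d ->
    normc (f z - f p - D * (z - p)) <= e * normc (z - p).

Lemma cdiff_is_derive (f : C -> C) (p D : C) :
  cdiff f p D <-> is_derive p 1 f D.
Proof.
split=> [H|[dv dE]].
  have cv : (fun h => h^-1 *: (f (h *: 1 + p) - f p)) @ 0^' --> D.
    apply/cvgrPdist_le => e e0.
    have [r r0 er] : exists2 r : R, 0 < r & r%:C = e.
      case: e e0 => a b; rewrite ltcE /= => /andP[/eqP -> a0].
      by exists a.
    have [d d0 hd] := H r r0.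
    have d0' : (0 : C) < d%:C by rewrite ltcR.
    rewrite /dnbhs; apply/nbhs_ballP; exists d%:C => //= h.
    rewrite /ball /= sub0r normrN => hlt h0.
    have hlt' : normc h < d by rewrite -ltcR.
    have hp : h *: 1 + p - p = h by rewrite addrK; exact: mulr1.
    have := hd (h *: 1 + p); rewrite hp => /(_ hlt') hh.
    have nh : 0 < normc h.
      rewrite lt_neqAle normc_ge0 andbT eq_sym; apply: contra h0 => /eqP/eq0_normc ->//.
    rewrite -er distrC complex_normE lecR.
    have -> : h^-1 *: (f (h *: 1 + p) - f p) - D =
       h^-1 * (f (h *: 1 + p) - f p - D * h).
      rewrite -[_ *: _]/(_ * _); field; exact: h0.
    by rewrite normcM normcV ler_pdivrMl// [leRHS]mulrC.
  have dd : derivable f p 1 by apply/cvg_ex; exists D.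
  split=> //; apply: cvg_lim cv; exact: norm_hausdorff.
move=> e e0.
have cv : (fun h => h^-1 *: (f (h *: 1 + p) - f p)) @ 0^' --> D.
  by rewrite -dE; exact: dv.
have e0' : (0 : C) < e%:C by rewrite ltcR.
move/cvgrPdist_le : cv => /(_ _ e0') /nbhs_ballP [d /= d0 hd].
case: d d0 hd => a b; rewrite ltcE /= => /andP[/eqP -> a0] hd.
exists a => // z za.
have [->|zp] := eqVneq z p; first by rewrite !subrr mulr0 subr0 normc0 mulr0.
have zp0 : z - p != 0 by rewrite subr_eq0.
have nz : 0 < normc (z - p).
  rewrite lt_neqAle normc_ge0 andbT eq_sym; apply: contra zp0 => /eqP/eq0_normc ->//.
have := hd (z - p).
rewrite /ball /= sub0r normrN complex_normE ltcR => /(_ za zp0).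
rewrite distrC complex_normE lecR.
have -> : (z - p) *: 1 + p = z by rewrite [_ *: _]mulr1 subrK.
have -> : (z - p)^-1 *: (f z - f p) - D = (z - p)^-1 * (f z - f p - D * (z - p)).
  by rewrite -[_ *: _]/(_ * _); field.
by rewrite normcM normcV ler_pdivrMl// [leRHS]mulrC.
Qed.

Lemma differentiable_cdiff (f : C -> C) (p : C) :
  differentiable f p -> cdiff f p ('D_1 f p).
Proof.
move=> /derivable1_diffP df; apply/cdiff_is_derive; exact: derivableP.
Qed.

Lemma cdiff_differentiable (f : C -> C) (p D : C) : cdiff f p D -> differentiable f p.
Proof. by move=> /cdiff_is_derive[df _]; apply/derivable1_diffP. Qed.

Lemma cdiff_unique (f : C -> C) (p D : C) : cdiff f p D -> 'D_1 f p = D.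
Proof. by move=> /cdiff_is_derive[_ df]. Qed.

(** The complex exponential. *)
Definition cexp (w : C) : C :=
  (expR (Re w) * cos (Im w)) +i* (expR (Re w) * sin (Im w)).

Lemma cexp0 : cexp 0 = 1.
Proof. by rewrite /cexp /= expR0 cos0 sin0 !mul1r. Qed.

Lemma cexpD w z : cexp (w + z) = cexp w * cexp z.
Proof.
case: w z => [a b] [c d]; rewrite /cexp /= expRD cosD sinD.
by apply/eqP; rewrite eq_complex /=; apply/andP; split; apply/eqP; ring.
Qed.

Lemma normc_cexp w : normc (cexp w) = expR (Re w).
Proof.
rewrite /cexp /normc !exprMn -mulrDr cos2Dsin2 mulr1 sqrtr_sqr.
by rewrite ger0_norm// expR_ge0.
Qed.

Lemma cexp_neq0 w : cexp w != 0.
Proof.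
apply/eqP => /(congr1 (@normc R)); rewrite normc_cexp normc0 => /eqP.
by rewrite gt_eqF// expR_gt0.
Qed.

Lemma real_derive_eps (f : R -> R) (D : R) : is_derive (0 : R) 1 f D ->
  forall e, 0 < e -> exists2 d, 0 < d & forall x, `|x| < d ->
    `|f x - f 0 - D * x| <= e * `|x|.
Proof.
move=> [dv dE] e e0.
have cv : (fun h => h^-1 *: (f (h *: 1 + 0) - f 0)) @ 0^' --> D.
  by rewrite -dE; exact: dv.
move/cvgrPdist_le : cv => /(_ _ e0) /nbhs_ballP [d /= d0 hd].
exists d => // x xd; have [->|x0] := eqVneq x 0.
  by rewrite !subrr mulr0 subr0 normr0 mulr0.
have := hd x; rewrite /ball /= sub0r normrN => /(_ xd x0).
rewrite distrC addr0 [x *: 1]mulr1.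
have -> : x^-1 *: (f x - f 0) - D = x^-1 * (f x - f 0 - D * x).
  by rewrite -[_ *: _]/(_ * _); field.
by rewrite normrM normfV ler_pdivrMl ?normr_gt0// [leRHS]mulrC.
Qed.

Lemma cdiff_cexp w : cdiff cexp w (cexp w).
Proof.
have c0 : cdiff cexp 0 1.
  move=> e e0; have e8 : 0 < e / 8 by rewrite divr_gt0.
  have [a a0 ha] := @real_derive_eps expR 1 ltac:(by apply: is_derive_eq; rewrite expR0) _ e8.
  have [b b0 hb] := @real_derive_eps cos 0 ltac:(by apply: is_derive_eq; rewrite sin0 oppr0) _ e8.
  have [c c0 hc] := @real_derive_eps sin 1 ltac:(by apply: is_derive_eq; rewrite cos0) _ e8.
  exists (Num.min (Num.min a b) (Num.min c (Num.min 1 (e / 8)))).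
    by rewrite !lt_min a0 b0 c0 e8 ltr01.
  move=> [x y]; rewrite subr0 !lt_min mul1r cexp0.
  move=> /andP[/andP[na nb] /andP[nc /andP[n1 ne]]].
  have rx := Re_le_normc (x +i* y); have ry := Im_le_normc (x +i* y).
  set n := normc _ in na nb nc n1 ne rx ry *; rewrite /= in rx ry.
  have n0 : 0 <= n by exact: normc_ge0.
  have := ha x (le_lt_trans rx na); have := hb y (le_lt_trans ry nb).
  have := hc y (le_lt_trans ry nc).
  rewrite expR0 cos0 sin0 mul0r !subr0 !mul1r => hs hcs hx.
  have -> : cexp (x +i* y) - 1 - (x +i* y) =
    ((expR x - 1 - x) * cos y + (1 + x) * (cos y - 1)) +i*
    ((expR x - 1 - x) * sin y + (1 + x) * (sin y - y) + x * y).
    apply/eqP; rewrite eq_complex /=; apply/andP; split; apply/eqP; ring.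
  apply: le_trans (normc_le_parts _ _) _.
  have cy : `|cos y| <= 1 by rewrite ler_norml cos_geN1 cos_le1.
  have sy : `|sin y| <= 1 by rewrite ler_norml sin_geN1 sin_le1.
  have x2 : `|1 + x| <= 2 by rewrite (le_trans (ler_normD _ _))// normr1; lra.
  have t1 : `|(expR x - 1 - x) * cos y| <= e / 8 * n.
    rewrite normrM -[leRHS]mulr1; apply: ler_pM => //.
    by apply: le_trans hx _; rewrite ler_pM2l.
  have t2 : `|(expR x - 1 - x) * sin y| <= e / 8 * n.
    rewrite normrM -[leRHS]mulr1; apply: ler_pM => //.
    by apply: le_trans hx _; rewrite ler_pM2l.
  have t3 : `|(1 + x) * (cos y - 1)| <= 2 * (e / 8 * n).
    rewrite normrM; apply: ler_pM => //.
    by apply: le_trans hcs _; rewrite ler_pM2l.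
  have t4 : `|(1 + x) * (sin y - y)| <= 2 * (e / 8 * n).
    rewrite normrM; apply: ler_pM => //.
    by apply: le_trans hs _; rewrite ler_pM2l.
  have t5 : `|x * y| <= e / 8 * n.
    rewrite normrM; apply: ler_pM => //; exact: le_trans rx (ltW ne).
  apply: (@le_trans _ _ (`|(expR x - 1 - x) * cos y| + `|(1 + x) * (cos y - 1)| +
    (`|(expR x - 1 - x) * sin y| + `|(1 + x) * (sin y - y)| + `|x * y|))).
    apply: lerD; first exact: ler_normD.
    by apply: le_trans (ler_normD _ _) _; rewrite lerD2r ler_normD.
  have := mulr_ge0 (ltW e0) n0; lra.
move=> e e0; have n0 : 0 < normc (cexp w) by rewrite normc_cexp expR_gt0.
have [d d0 hd] := c0 (e / normc (cexp w)) (divr_gt0 e0 n0).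
exists d => // z zw.
have -> : cexp z = cexp w * cexp (z - w) by rewrite -cexpD addrC subrK.
have := hd (z - w); rewrite subr0 cexp0 mul1r => /(_ zw).
have -> : cexp w * cexp (z - w) - cexp w - cexp w * (z - w) =
  cexp w * (cexp (z - w) - 1 - (z - w)) by ring.
by rewrite normcM -ler_pdivlMl// mulrCA mulrA.
Qed.

End CDiff.

(** * Cauchy's inequality *)

Section Coef.
Context {R : realType}.
Local Notation C := R[i].

Section Pointwise.
Variable V : normedModType C.
Implicit Types (f g : V -> C) (x : V).

Lemma differentiable_const (k : C) x : differentiable (fun _ : V => k) x.
Proof. exact: (@differentiable_cst _ _ _ k x). Qed.

Lemma differentiable_add f g x : differentiable f x -> differentiable g x ->
  differentiable (fun z => f z + g z) x.
Proof. exact: differentiableD. Qed.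

Lemma differentiable_sub f g x : differentiable f x -> differentiable g x ->
  differentiable (fun z => f z - g z) x.
Proof. exact: differentiableB. Qed.

Lemma differentiable_mul f g x : differentiable f x -> differentiable g x ->
  differentiable (fun z => f z * g z) x.
Proof. exact: differentiableM. Qed.

Lemma differentiable_pow f n x :
  differentiable f x -> differentiable (fun z => f z ^+ n) x.
Proof.
move=> df; elim: n => [|n IH]; first exact: differentiable_const.
rewrite (_ : (fun z => _) = (fun z => f z * f z ^+ n)).
  exact: differentiable_mul.
by apply/funext => z; rewrite exprS.
Qed.

End Pointwise.

Lemma differentiable_idC (z : C) : differentiable (fun w : C => w) z.
Proof. by apply: ex_diff; exact: is_diff_id. Qed.

Lemma cexp_2pi (w : C) : cexp (w + 0 +i* (pi *+ 2)) = cexp w.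
Proof.
rewrite cexpD [X in _ * X](_ : _ = 1) ?mulr1//.
by rewrite /cexp /= expR0 cos2pi sin2pi !mul1r.
Qed.

(** Cauchy's inequality |c| r^n <= M for the leading Taylor coefficient.
    The function g(w) = f(exp w) / exp(n w) has period 2 pi i, so Goursat's
    lemma on the rectangle [x1, ln r] x [0, 2 pi] shows that the means of g on
    the two vertical sides agree.  The right one is at most M / r^n; the left
    one tends to c as x1 goes to -oo. *)
Lemma taylor_coef_bound (f : C -> C) (r M : R) (c : C) (n : nat) : 0 < r ->
  (forall z, normc z <= r -> differentiable f z) ->
  (forall z, normc z = r -> normc (f z) <= M) ->
  (forall e, 0 < e -> exists2 d, 0 < d & forall z, normc z < d ->
      normc (f z - c * z ^+ n) <= e * normc z ^+ n) ->
  normc c * r ^+ n <= M.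
Proof.
move=> r0 df fM fc; have rn : 0 < r ^+ n by exact: exprn_gt0.
rewrite -ler_pdivlMr// leNgt; apply/negP => cM.
(* a third of the gap: one for each of the means over the two sides, one to spare *)
pose e := (normc c - M / r ^+ n) / 3.
have e0 : 0 < e by rewrite divr_gt0// subr_gt0.
have [d d0 hd] := fc e e0.
pose x1 := ln (Num.min d r / 2); pose x2 := ln r.
have m0 : 0 < Num.min d r / 2 by rewrite divr_gt0// lt_min d0 r0.
have ex1 : expR x1 = Num.min d r / 2 by rewrite lnK// posrE.
have ex2 : expR x2 = r by rewrite lnK// posrE.
have md : Num.min d r / 2 < d.
  have : Num.min d r <= d by rewrite ge_min lexx.
  lra.
have mr : Num.min d r / 2 < r.
  have : Num.min d r <= r by rewrite ge_min lexx orbT.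
  lra.
have x12 : x1 < x2 by rewrite -ltr_expR ex1 ex2.
pose g z := f z * (z ^+ n)^-1.
pose G := g \o cexp.
pose v1 : C := (x2 - x1)%:C; pose v2 : C := 0 +i* (pi *+ 2).
have G_per w : G (w + v2) = G w by rewrite /G /= cexp_2pi.
have dG w : complex.Re w <= x2 -> differentiable G w.
  move=> wx; apply: differentiable_comp.
    exact: cdiff_differentiable (cdiff_cexp w).
  apply: differentiable_mul.
    by apply: df; rewrite normc_cexp -ex2 ler_expR.
  apply: differentiableV; last by rewrite expf_neq0// cexp_neq0.
  by apply: differentiable_pow; exact: differentiable_idC.
have nG w : normc (G w) = normc (f (cexp w)) / (expR (complex.Re w)) ^+ n.
  by rewrite /G /g /= normcM normcV normcX normc_cexp.
have [|m0' hm] := @goursat R G x1%:C v1 v2 _ (pi * e) (mulr_gt0 (pi_gt0 R) e0).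
  move=> s t /andP[s0 s1] _ p; exists ('D_1 G p); apply: differentiable_cdiff.
  apply: dG; rewrite /p /v1 /v2 /=.
  have : s * (x2 - x1) <= x2 - x1 by rewrite ler_piMl// subr_ge0 ltW.
  lra.
have := hm m0' (leqnn _); rewrite /boundary_sum.
set A1 := edge_mean _ _ _ _; set A2 := edge_mean _ _ _ _; set A3 := edge_mean _ _ _ _; set A4 := edge_mean _ _ _ _.
have -> : A3 = A1.
  rewrite /A3 /A1 /edge_mean; congr (_ / _); apply: eq_bigr => k _.
  by rewrite addrAC G_per.
have -> : v1 * A1 + v2 * A2 - v1 * A1 - v2 * A4 = v2 * (A2 - A4) by ring.
have nv2 : normc v2 = 2 * pi.
  rewrite /v2 /normc expr0n add0r sqrtr_sqr ger0_norm ?mulr_natl//.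
  by rewrite mulrn_wge0// pi_ge0.
rewrite normcM nv2 => hA.
have {}hA : normc (A2 - A4) <= e.
  have p0 := pi_gt0 R; rewrite -(ler_pM2l (_ : 0 < 2 * pi)) ?mulr_gt0//.
  apply: le_trans hA _; rewrite ler_pM2r// ler_peMl// ?ltW//; lra.
have hA2 : normc A2 <= M / r ^+ n.
  apply: edge_mean_le => [|s _].
    rewrite divr_ge0 ?(ltW rn)//; apply: le_trans (normc_ge0 (f r%:C)) _.
    by apply: fM; rewrite normc_real gtr0_norm.
  have re : complex.Re (x1%:C + v1 + s%:C * v2) = x2.
    by rewrite /v1 /v2 /=; ring.
  rewrite nG re ex2 ler_pM2r ?invr_gt0//; apply: fM.
  by rewrite normc_cexp re.
have hA4 : normc (A4 - c) <= e.
  have -> : A4 - c = edge_mean (fun z => G z - (c + 0 * z)) x1%:C v2 (2 ^ m0').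
    by rewrite edge_meanB edge_mean_affine ?expn_gt0// mul0r addr0.
  apply: edge_mean_le => [|s _]; first exact: ltW.
  rewrite mul0r addr0; set w := x1%:C + _.
  have re : complex.Re w = x1 by rewrite /w /v2 /=; ring.
  have z0 := cexp_neq0 w.
  have -> : G w - c = (f (cexp w) - c * cexp w ^+ n) / cexp w ^+ n.
    by rewrite /G /g /=; field; rewrite expf_neq0.
  have nz : normc (cexp w) = Num.min d r / 2 by rewrite normc_cexp re.
  rewrite normcM normcV normcX ler_pdivrMr ?exprn_gt0 ?nz// -nz.
  by apply: hd; rewrite nz.
have : normc c <= M / r ^+ n + e + e.
  have -> : c = (A2 - (A4 - c)) - (A2 - A4) by ring.
  rewrite (le_trans (normcB_le _ _))// lerD//.
  by rewrite (le_trans (normcB_le _ _))// lerD.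
rewrite /e in e0 *; lra.
Qed.

End Coef.

(** * Consequences in one variable *)

Section OneVariable.
Context {R : realType}.
Local Notation C := R[i].
Implicit Types (f g : C -> C) (z p a : C) (r M K : R).

(** Continuity at 0 in the form asked for by [taylor_coef_bound] with
    [n = 0]. *)
Lemma differentiable_near0 f : differentiable f 0 ->
  forall e, 0 < e -> exists2 d, 0 < d & forall z, normc z < d ->
    normc (f z - f 0) <= e.
Proof.
move=> /differentiable_cdiff; set D := 'D_1 f 0 => df e e0.
have [d d0 hd] := df 1 ltr01.
have D1 : 0 < 1 + normc D by rewrite ltr_wpDr ?normc_ge0.
exists (Num.min d (e / (1 + normc D))); first by rewrite lt_min d0 divr_gt0.
move=> z; rewrite lt_min ltr_pdivlMr// => /andP[zd ze].
have := hd z; rewrite subr0 mul1r => /(_ zd) hz.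
have tri := normcD_le (f z - f 0 - D * z) (D * z).
rewrite subrK normcM in tri.
apply: le_trans tri _; apply: le_trans (ltW ze).
by rewrite mulrDr mulr1 [normc z * _]mulrC lerD2r.
Qed.

Lemma differentiable_shift f p z : differentiable f (z + p) ->
  differentiable (fun z => f (z + p)) z.
Proof.
move=> df; have dh : differentiable (fun z : C => z + p) z.
  by apply: differentiable_add; [exact: differentiable_idC|exact: differentiable_const].
exact: (@differentiable_comp _ _ _ _ (fun z => z + p) f z dh df).
Qed.

Lemma derive_sub f g p : differentiable f p -> differentiable g p ->
  'D_1 (fun z => f z - g z) p = 'D_1 f p - 'D_1 g p.
Proof.
by move=> /derivable1_diffP df /derivable1_diffP dg; exact: deriveB df dg.
Qed.

Lemma derive_shiftC f p : differentiable f p ->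
  'D_1 (fun z => f (z + p)) 0 = 'D_1 f p.
Proof.
move=> /differentiable_cdiff df; apply: cdiff_unique => e e0.
have [d d0 hd] := df e e0; exists d => // z; rewrite !subr0 => zd.
by have := hd (z + p); rewrite addrK add0r => /(_ zd).
Qed.

Lemma cauchy_derivative f p r M : 0 < r ->
  (forall z, normc (z - p) <= r -> differentiable f z) ->
  (forall z, normc (z - p) = r -> normc (f z - f p) <= M) ->
  normc ('D_1 f p) * r <= M.
Proof.
move=> r0 df fM; rewrite -[X in _ * X]expr1.
have dfp : differentiable f p by apply: df; rewrite subrr normc0 ltW.
apply: (@taylor_coef_bound R (fun z => f (z + p) - f p)); first exact: r0.
- move=> z zr; apply: differentiable_sub; last exact: differentiable_const.
  by apply: differentiable_shift; apply: df; rewrite addrK.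
- by move=> z zr; apply: fM; rewrite addrK.
move=> e e0; have [d d0 hd] := differentiable_cdiff dfp e0.
exists d => // z zd; rewrite !expr1.
by have := hd (z + p); rewrite addrK; apply.
Qed.

Lemma mean_value_complex g a v K :
  (forall t : R, 0 <= t <= 1 -> differentiable g (a + t%:C * v)) ->
  (forall t : R, 0 <= t <= 1 -> normc ('D_1 g (a + t%:C * v)) <= K) ->
  normc (g (a + v) - g a) <= K * normc v.
Proof.
move=> dg gK.
have [->|v0] := eqVneq v 0; first by rewrite addr0 subrr normc0 mulr0.
have nv : 0 < normc v.
  rewrite lt_neqAle normc_ge0 andbT eq_sym; apply: contra v0 => /eqP/eq0_normc ->//.
rewrite -ler_pdivrMr//; apply/ler_addgt0Pr => e e0.
rewrite ler_pdivrMr//.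
have := @mean_value_ineq R (fun t => g (a + t%:C * v)) ((K + e) * normc v).
rewrite mul1r mul0r addr0; apply => t t01.
have [d d0 hd] := differentiable_cdiff (dg t t01) e0.
exists (d / normc v) => [|s]; first exact: divr_gt0.
rewrite ltr_pdivlMr// => st.
have E : a + s%:C * v - (a + t%:C * v) = (s - t)%:C * v by rewrite rmorphB /=; ring.
have N : normc ((s - t)%:C * v) = `|s - t| * normc v by rewrite normcM normc_real.
have := hd (a + s%:C * v); rewrite E N => /(_ st) h.
have tri := normcD_le (g (a + s%:C * v) - g (a + t%:C * v) -
   'D_1 g (a + t%:C * v) * ((s - t)%:C * v)) ('D_1 g (a + t%:C * v) * ((s - t)%:C * v)).
rewrite subrK normcM N in tri; apply: le_trans tri _.
have -> : (K + e) * normc v * `|s - t| = e * (`|s - t| * normc v) + K * (`|s - t| * normc v) by ring.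
apply: lerD => //; apply: ler_wpM2r; last exact: gK.
by rewrite mulr_ge0// ltW.
Qed.

Lemma segment_disc (a b : C) r (t : R) : 0 <= t <= 1 ->
  normc a <= r -> normc b <= r -> normc (a + t%:C * (b - a)) <= r.
Proof.
move=> /andP[t0 t1] ar br.
have -> : a + t%:C * (b - a) = (1 - t)%:C * a + t%:C * b by rewrite rmorphB /=; ring.
apply: le_trans (normcD_le _ _) _; rewrite !normcM !normc_real !ger0_norm ?subr_ge0//.
have -> : r = (1 - t) * r + t * r by ring.
by apply: lerD; apply: ler_wpM2l; rewrite ?subr_ge0.
Qed.

Lemma bounded_lipschitz g r M : 0 < r ->
  (forall z, normc z <= r -> differentiable g z) ->
  (forall z, normc z <= r -> normc (g z) <= M) ->
  forall z w, normc z <= r / 2 -> normc w <= r / 2 ->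
    normc (g z - g w) <= 4 * M / r * normc (z - w).
Proof.
move=> r0 dg gM z w zr wr.
have -> : z = w + (z - w) by ring.
rewrite [w + _ - w]addrAC subrr add0r.
have rr : normc w <= r / 2 -> normc w <= r by move=> h; apply: le_trans h _; lra.
apply: mean_value_complex => t t01; have h := segment_disc t01 wr zr.
  by apply: dg; apply: le_trans h _; lra.
set p := _ + _ in h *.
have hp u : normc (u - p) <= r / 2 -> normc u <= r.
  by move=> hu; have := normcD_le (u - p) p; rewrite subrK; lra.
have := @cauchy_derivative g p (r / 2) (2 * M) ltac:(lra) (fun u hu => dg u (hp u hu)).
rewrite -ler_pdivlMr; last lra.
have -> : 2 * M / (r / 2) = 4 * M / r by field; rewrite gt_eqF.
apply=> u hu; apply: le_trans (normcB_le _ _) _.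
have := gM u (hp u _); rewrite hu lexx => /(_ isT).
have := gM p; have : normc p <= r by lra.
move=> -> /(_ isT); lra.
Qed.

(** The difference quotient functions u |-> g (u + l) - g u are O(l), hence
    so are their derivatives at 0 by Cauchy's inequality: g' is Lipschitz
    at 0, and the mean value inequality for g(u) - g'(0) u gives the remainder. *)
Lemma second_order_remainder g r M : 0 < r ->
  (forall z, normc z <= r -> differentiable g z) ->
  (forall z, normc z <= r -> normc (g z) <= M) ->
  forall z, normc z <= r / 4 ->
    normc (g z - g 0 - 'D_1 g 0 * z) <= 32 * M / r ^+ 2 * normc z ^+ 2.
Proof.
move=> r0 dg gM z zr; set D := 'D_1 g 0.
have lip := bounded_lipschitz r0 dg gM.
have M0 : 0 <= M by apply: le_trans (normc_ge0 (g 0)) (gM _ _); rewrite normc0 ltW.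
have der l : normc l <= r / 4 ->
    normc ('D_1 g l - D) <= 32 * M / r ^+ 2 * normc l.
  move=> lr.
  have dl u : normc (u - 0) <= r / 4 -> differentiable (fun u => g (u + l) - g u) u.
    rewrite subr0 => ur; apply: differentiable_sub; last by apply: dg; lra.
    by apply: differentiable_shift; apply: dg; have := normcD_le u l; lra.
  have := @cauchy_derivative _ 0 (r / 4) (2 * (4 * M / r * normc l)) ltac:(lra) dl.
  have -> : 'D_1 (fun u => g (u + l) - g u) 0 = 'D_1 g l - D.
    have dgl : differentiable g l by apply: dg; lra.
    have dg0 : differentiable g 0 by apply: dg; rewrite normc0 ltW.
    rewrite derive_sub; last exact: dg0; last first.
      by apply: differentiable_shift; rewrite add0r; exact: dgl.
    by rewrite derive_shiftC; last exact: dgl.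
  rewrite -ler_pdivlMr; last lra.
  have -> : 2 * (4 * M / r * normc l) / (r / 4) = 32 * M / r ^+ 2 * normc l.
    by field; rewrite gt_eqF.
  apply=> u; rewrite subr0 => ur; rewrite add0r; apply: le_trans (normcB_le _ _) _.
  have := lip (u + l) u; have := lip l 0.
  have -> : u + l - u = l by ring.
  rewrite subr0 normc0 => /(_ ltac:(lra) ltac:(lra)) h1 /(_ _ ltac:(lra)) h2.
  have := h2 ltac:(have := normcD_le u l; lra); lra.
have := @mean_value_complex (fun u => g u - D * u) 0 z (32 * M / r ^+ 2 * normc z).
rewrite !add0r mulr0 subr0.
have -> : 32 * M / r ^+ 2 * normc z * normc z = 32 * M / r ^+ 2 * normc z ^+ 2.
  by rewrite expr2 mulrA.
have -> : g z - D * z - g 0 = g z - g 0 - D * z by ring.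
apply=> t /andP[t0 t1]; rewrite add0r; set u := _ * _.
  have nu : normc u <= normc z.
    by rewrite /u normcM normc_real ger0_norm// ler_piMl// normc_ge0.
  apply: differentiable_sub; first by apply: dg; lra.
  by apply: differentiable_mul; [exact: differentiable_const|exact: differentiable_idC].
have nu : normc u <= normc z.
  by rewrite /u normcM normc_real ger0_norm// ler_piMl// normc_ge0.
have dgu : differentiable g u by apply: dg; lra.
have -> : 'D_1 (fun u => g u - D * u) u = 'D_1 g u - D.
  apply: cdiff_unique => e e0; have [d d0 hd] := differentiable_cdiff dgu e0.
  exists d => // w /hd.
  by congr (normc _ <= _); ring.
apply: le_trans (der u _) _; first lra.
by apply: ler_wpM2l => //; apply: divr_ge0; [exact: mulr_ge0|apply: exprn_ge0; exact: ltW].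
Qed.

(** Move the point [a] to the centre by a disc automorphism and use
    [taylor_coef_bound] with [n = 0]. *)
Lemma max_modulus_disc f M : (forall z, differentiable f z) ->
  (forall z, normc z = 1 -> normc (f z) <= M) ->
  forall a, normc a < 1 -> normc (f a) <= M.
Proof.
move=> df fM a a1.
(* the automorphism that sends 0 to a *)
pose m z := (z + a) * (1 + conjc a * z)^-1.
have m0 : m 0 = a by rewrite /m mulr0 addr0 invr1 mulr1 add0r.
have den z : normc z <= 1 -> 1 + conjc a * z != 0.
  move=> z1; apply/eqP => /eqP; rewrite addrC addr_eq0 => /eqP/(congr1 (@normc R)).
  rewrite normcM normc_conj normc_opp normc1 => h.
  have : normc a * normc z <= normc a * 1 by apply: ler_wpM2l => //; exact: normc_ge0.
  by rewrite h mulr1 => /le_lt_trans /(_ a1); rewrite ltxx.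
have dm z : normc z <= 1 -> differentiable m z.
  move=> z1; apply: differentiable_mul.
    by apply: differentiable_add; [exact: differentiable_idC|exact: differentiable_const].
  apply: differentiableV; last exact: den.
  apply: differentiable_add; first exact: differentiable_const.
  by apply: differentiable_mul; [exact: differentiable_const|exact: differentiable_idC].
have m1 z : normc z = 1 -> normc (m z) = 1.
  move=> z1.
  have zz : z * conjc z = 1 by rewrite -normc_sqr_conj z1 expr1n.
  have -> : m z = z * (conjc (1 + conjc a * z) / (1 + conjc a * z)).
    have -> : conjc (1 + conjc a * z) = 1 + a * conjc z.
      by rewrite rmorphD rmorph1 rmorphM /= conjcK.
    by rewrite /m mulrA mulrDr mulr1 mulrCA zz mulr1.
  rewrite !normcM z1 mul1r normc_conj normcV divff//.
  by apply/eqP => /eq0_normc/eqP; apply/negP; apply: den; rewrite z1.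
have dfm z : normc z <= 1 -> differentiable (f \o m) z.
  by move=> z1; apply: differentiable_comp; [exact: dm|exact: df].
suff : normc (f a) * 1 ^+ 0 <= M by rewrite mulr1.
apply: (taylor_coef_bound ltr01 dfm) => [z z1|e e0]; first by apply: fM; exact: m1.
have m00 : normc (0 : C) <= 1 by rewrite normc0.
have [d d0 hd] := differentiable_near0 (dfm 0 m00) e0.
exists d; first exact: d0.
by move=> z /hd; rewrite !expr0 !mulr1 /comp m0.
Qed.

End OneVariable.

(** * A quartic in the symmetric functions *)

Section Torus.
Context {R : realType}.
Local Notation C := R[i].

Lemma convex_le_endpoints (al be ga p q x M : R) : 0 <= al -> p <= x <= q ->
  al * p ^+ 2 + be * p + ga <= M -> al * q ^+ 2 + be * q + ga <= M ->
  al * x ^+ 2 + be * x + ga <= M.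
Proof.
move=> al0 /andP[px xq] hp hq.
have [pq|pq] := leP q p; first by have -> : x = p by lra.
rewrite -(ler_pM2l (_ : 0 < q - p)) ?subr_gt0//.
have h1 : (q - x) * (al * p ^+ 2 + be * p + ga) <= (q - x) * M.
  by apply: ler_wpM2l; rewrite ?subr_ge0.
have h2 : (x - p) * (al * q ^+ 2 + be * q + ga) <= (x - p) * M.
  by apply: ler_wpM2l; rewrite ?subr_ge0.
have h3 : 0 <= al * (q - p) * (x - p) * (q - x).
  by rewrite !mulr_ge0 ?subr_ge0// ltW.
lra.
Qed.

(** With [quartic_c], close to the coefficients that minimize the maximum of
    |s2^2 + B s1^2 s2 + C s1^4| on the torus; the minimum is about 1.4792. *)
Definition quartic_b : R := - (431 / 1000).
Definition quartic_c : R := 486 / 100 / 100.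

(** Here r = |s1| and T = Re (s1^3 conj s3) for a triple of unimodular
    numbers, the left-hand side is the squared modulus of [quartic] in these
    coordinates, and the last hypothesis says that the discriminant has the
    right sign.  The left-hand side is convex in T, so it is enough to look at
    the end points: T = r^3 on one side, and on the other T = - r^3 when
    r <= 1 and vanishing discriminant when r >= 1. *)
Lemma deltoid_bound (r T : R) : 0 <= r <= 3 -> - r ^+ 3 <= T <= r ^+ 3 ->
  r ^+ 4 + 18 * r ^+ 2 - 27 <= 8 * T ->
  4 * quartic_c * T ^+ 2 + (2 * quartic_b * r ^+ 2 + 2 * quartic_b * quartic_c * r ^+ 4) * T +
    (r ^+ 4 + quartic_b ^+ 2 * r ^+ 6 + quartic_c ^+ 2 * r ^+ 8 - 2 * quartic_c * r ^+ 6) <= (37 / 25) ^+ 2.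
Proof.
move=> /andP[r0 r3] /andP[Tl Tu] disc.
have C0 : 0 <= 4 * quartic_c by rewrite /quartic_c; lra.
have up : 4 * quartic_c * (r ^+ 3) ^+ 2 + (2 * quartic_b * r ^+ 2 + 2 * quartic_b * quartic_c * r ^+ 4) * r ^+ 3 +
    (r ^+ 4 + quartic_b ^+ 2 * r ^+ 6 + quartic_c ^+ 2 * r ^+ 8 - 2 * quartic_c * r ^+ 6) <= (37 / 25) ^+ 2.
  have -> : 4 * quartic_c * (r ^+ 3) ^+ 2 + (2 * quartic_b * r ^+ 2 + 2 * quartic_b * quartic_c * r ^+ 4) * r ^+ 3 +
    (r ^+ 4 + quartic_b ^+ 2 * r ^+ 6 + quartic_c ^+ 2 * r ^+ 8 - 2 * quartic_c * r ^+ 6) =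
    (r ^+ 2 * (1 + quartic_b * r + quartic_c * r ^+ 2)) ^+ 2 by ring.
  have q0 : 0 <= 1 + quartic_b * r + quartic_c * r ^+ 2 by rewrite /quartic_b /quartic_c; nra.
  rewrite ler_sqr ?nnegrE; [|by rewrite mulr_ge0// sqr_ge0|by lra].
  (* the polynomial is maximal near r = 2.45, with value about 1.416 *)
  have h : 0 <= (r - 245 / 100) ^+ 2 * (236 / 1000 + 193 / 1000 * r - 486 / 100 / 100 * r ^+ 2).
    apply: mulr_ge0; first exact: sqr_ge0.
    by have : 0 <= r * (3 - r) by [rewrite mulr_ge0// subr_ge0]; lra.
  have r33 : r ^+ 3 <= 3 ^+ 3 by rewrite lerXn2r ?nnegrE.
  by have := sqr_ge0 r; rewrite /quartic_b /quartic_c; lra.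
have [r1|/ltW r1] := leP r 1.
  apply: (@convex_le_endpoints _ _ _ (- r ^+ 3) (r ^+ 3)) => //; first by rewrite Tl.
  have -> : 4 * quartic_c * (- r ^+ 3) ^+ 2 + (2 * quartic_b * r ^+ 2 + 2 * quartic_b * quartic_c * r ^+ 4) * (- r ^+ 3) +
    (r ^+ 4 + quartic_b ^+ 2 * r ^+ 6 + quartic_c ^+ 2 * r ^+ 8 - 2 * quartic_c * r ^+ 6) =
    (r ^+ 2 * (1 - quartic_b * r + quartic_c * r ^+ 2)) ^+ 2 by ring.
  have q0 : 0 <= 1 - quartic_b * r + quartic_c * r ^+ 2 by rewrite /quartic_b /quartic_c; nra.
  have q1 : 1 - quartic_b * r + quartic_c * r ^+ 2 <= 37 / 25 by rewrite /quartic_b /quartic_c; nra.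
  rewrite ler_sqr ?nnegrE; [|by rewrite mulr_ge0// sqr_ge0|by lra].
  have : r ^+ 2 <= 1 by rewrite expr_le1.
  by have := sqr_ge0 r; nra.
apply: (@convex_le_endpoints _ _ _ ((r ^+ 4 + 18 * r ^+ 2 - 27) / 8) (r ^+ 3)) => //.
  by rewrite Tu andbT; lra.
pose u := r ^+ 2 - 1.
have u0 : 0 <= u by rewrite /u; nra.
have u8 : u <= 8 by rewrite /u; nra.
have -> : 4 * quartic_c * ((r ^+ 4 + 18 * r ^+ 2 - 27) / 8) ^+ 2
   + (2 * quartic_b * r ^+ 2 + 2 * quartic_b * quartic_c * r ^+ 4) * ((r ^+ 4 + 18 * r ^+ 2 - 27) / 8) +
    (r ^+ 4 + quartic_b ^+ 2 * r ^+ 6 + quartic_c ^+ 2 * r ^+ 8 - 2 * quartic_c * r ^+ 6) =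
  4 * quartic_c * (((u + 1) ^+ 2 + 18 * (u + 1) - 27) / 8) ^+ 2
   + (2 * quartic_b * (u + 1) + 2 * quartic_b * quartic_c * (u + 1) ^+ 2) * (((u + 1) ^+ 2 + 18 * (u + 1) - 27) / 8) +
    ((u + 1) ^+ 2 + quartic_b ^+ 2 * (u + 1) ^+ 3 + quartic_c ^+ 2 * (u + 1) ^+ 4 - 2 * quartic_c * (u + 1) ^+ 3).
  by rewrite /u; ring.
have u2 := sqr_ge0 u.
have u3 : 0 <= u ^+ 3 by exact: exprn_ge0.
have u4 : 0 <= u ^+ 4 by exact: exprn_ge0.
(* rounded from below: the non-constant part of the gap, as a polynomial in u = r^2 - 1 *)
have key : 0 <= u * (108 / 100 / 100 - 107 / 100 / 100 * u + 344 / 100 / 100 / 10 * u ^+ 2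
    - 17 / 100 / 100 / 10 * u ^+ 3).
  apply: mulr_ge0; first exact: u0.
  have [v4|/ltW v4] := leP u 4.
    have : u ^+ 3 <= 4 * u ^+ 2 by rewrite exprS; apply: ler_wpM2r.
    by have := sqr_ge0 (u - 194 / 100); lra.
  have : u ^+ 3 <= 8 * u ^+ 2 by rewrite exprS; apply: ler_wpM2r.
  have : 4 * (u - 4) <= u * (u - 4) by apply: ler_wpM2r => //; lra.
  lra.
rewrite /quartic_b /quartic_c; lra.
Qed.

Definition elem1 (a b c : C) := a + b + c.
Definition elem2 (a b c : C) := a * b + b * c + c * a.
Definition elem3 (a b c : C) := a * b * c.

Definition quartic (x y : C) : C := y ^+ 2 + quartic_b%:C * x ^+ 2 * y + quartic_c%:C * x ^+ 4.

Lemma conjc_unit (a : C) : normc a = 1 -> a != 0 /\ conjc a = a^-1.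
Proof.
move=> a1; have a0 : a != 0.
  by apply/eqP => a0; move: a1; rewrite a0 normc0 => /eqP; rewrite eq_sym oner_eq0.
split=> //; apply: (mulfI a0); rewrite divff// -normc_sqr_conj a1 expr1n//.
Qed.

(** [S] and [S * conjc y] stand for s3 and s2 of a unimodular triple with
    s1 = [y]. *)
Lemma quartic_expand (r T : R) (y S : C) : y * conjc y = (r ^+ 2)%:C ->
  S * conjc S = 1 -> y ^+ 3 * conjc S + conjc y ^+ 3 * S = (2 * T)%:C ->
  normc (quartic y (S * conjc y)) ^+ 2 =
  4 * quartic_c * T ^+ 2 + (2 * quartic_b * r ^+ 2 + 2 * quartic_b * quartic_c * r ^+ 4) * T +
    (r ^+ 4 + quartic_b ^+ 2 * r ^+ 6 + quartic_c ^+ 2 * r ^+ 8 - 2 * quartic_c * r ^+ 6).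
Proof.
rewrite /quartic; move: quartic_b quartic_c => k l yy SS tt; apply: complexI; rewrite normc_sqr_conj.
have -> : (4 * l * T ^+ 2 + (2 * k * r ^+ 2 + 2 * k * l * r ^+ 4) * T +
    (r ^+ 4 + k ^+ 2 * r ^+ 6 + l ^+ 2 * r ^+ 8 - 2 * l * r ^+ 6))%:C =
  l%:C * (2 * T)%:C ^+ 2 + (k%:C * (r ^+ 2)%:C + k%:C * l%:C * (r ^+ 2)%:C ^+ 2) * (2 * T)%:C
  + ((r ^+ 2)%:C ^+ 2 + k%:C ^+ 2 * (r ^+ 2)%:C ^+ 3 + l%:C ^+ 2 * (r ^+ 2)%:C ^+ 4)
  - (2 : R)%:C * l%:C * (r ^+ 2)%:C ^+ 3.
  by rewrite -!(rcX, rcM, rcD, rcB); congr (_%:C); ring.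
rewrite rc_nat -tt -yy !(conjcD, conjcM, conjcX) !conjcK !conjc_real.
have S0 : S != 0.
  by apply/eqP => S0; move: SS; rewrite S0 mul0r => /esym/eqP; rewrite oner_eq0.
have -> : conjc S = S^-1 by apply: (mulfI S0); rewrite SS divff.
by field.
Qed.

(** Since conj a = 1/a on the unit circle, s2 = s3 conj s1, and the
    discriminant (a-b)^2 (b-c)^2 (c-a)^2 is a negative multiple of s3^2; this
    gives the constraint of [deltoid_bound]. *)
Lemma quartic_torus (a b c : C) : normc a = 1 -> normc b = 1 -> normc c = 1 ->
  normc (quartic (elem1 a b c) (elem2 a b c)) <= 37 / 25.
Proof.
move=> na nb nc.
have [a0 ca] := conjc_unit na; have [b0 cb] := conjc_unit nb.
have [c0 cc] := conjc_unit nc.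
set y := elem1 a b c; set S := elem3 a b c.
have y_conj : conjc y = a^-1 + b^-1 + c^-1 by rewrite /y !rmorphD /= ca cb cc.
have S_conj : conjc S = (a * b * c)^-1.
  by rewrite /S !rmorphM /= ca cb cc; field; apply/and3P.
have S0 : S != 0 by rewrite /S /elem3 !mulf_neq0.
have s2E : elem2 a b c = S * conjc y.
  by rewrite y_conj /S /elem3 /elem2; field; apply/and3P.
pose r := normc y; pose t := y ^+ 3 * conjc S; pose T := complex.Re t.
have yy : y * conjc y = (r ^+ 2)%:C by rewrite normc_sqr_conj.
have tt : t + conjc t = (2 * T)%:C by rewrite addcJ rmorphM rmorph_nat.
have {}tt : y ^+ 3 * conjc S + conjc y ^+ 3 * S = (2 * T)%:C.
  by rewrite -tt /t conjcM conjcX conjcK.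
have nS : normc S = 1 by rewrite /S !normcM na nb nc !mulr1.
have nt : normc t = r ^+ 3 by rewrite normcM normcX normc_conj nS mulr1.
have r0 : 0 <= r by exact: normc_ge0.
have r3 : r <= 3.
  rewrite /r /y /elem1; have := normcD_le (a + b) c; have := normcD_le a b.
  by rewrite na nb nc; lra.
have hT : - r ^+ 3 <= T <= r ^+ 3 by rewrite -ler_norml -nt Re_le_normc.
have disc : r ^+ 4 + 18 * r ^+ 2 - 27 <= 8 * T.
  have E : (r ^+ 4 + 18 * r ^+ 2 - 27 - 8 * T)%:C =
      (- (normc (a - b) ^+ 2 * normc (b - c) ^+ 2 * normc (c - a) ^+ 2))%:C.
    have -> : (r ^+ 4 + 18 * r ^+ 2 - 27 - 8 * T)%:C =
        (r ^+ 2)%:C ^+ 2 + 18 * (r ^+ 2)%:C - 27 - 4 * (2 * T)%:C.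
      by rewrite !(rmorphB, rmorphD, rmorphM, rmorphXn, rmorph_nat) /=; ring.
    have M3 (k l m : R) : (- (k * l * m))%:C = - (k%:C * l%:C * m%:C).
      by rewrite rmorphN !rmorphM.
    rewrite M3 !normc_sqr_conj !rmorphB /= ca cb cc.
    rewrite -tt S_conj y_conj /y /S /elem1 /elem3.
    by field; apply/and3P.
  move/complexI : E => E.
  have : 0 <= normc (a - b) ^+ 2 * normc (b - c) ^+ 2 * normc (c - a) ^+ 2.
    by apply: mulr_ge0; [apply: mulr_ge0|]; exact: sqr_ge0.
  lra.
have := deltoid_bound (introT andP (conj r0 r3)) hT disc.
set Q := (X in X <= _ -> _) => hQ.
have E : normc (quartic y (elem2 a b c)) ^+ 2 = Q.
  rewrite s2E; apply: quartic_expand => //.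
  by rewrite S_conj /S /elem3; field; apply/and3P.
rewrite -ler_sqr ?nnegrE ?normc_ge0//; last by lra.
Qed.

Lemma differentiable_quartic (V : normedModType C) (f g : V -> C) p :
  differentiable f p -> differentiable g p ->
  differentiable (fun z => quartic (f z) (g z)) p.
Proof.
move=> df dg.
rewrite /quartic; apply: differentiable_add; [apply: differentiable_add|].
- exact: differentiable_pow.
- apply: differentiable_mul; last exact: dg.
  apply: differentiable_mul; first exact: differentiable_const.
  exact: differentiable_pow.
- apply: differentiable_mul; first exact: differentiable_const.
  exact: differentiable_pow.
Qed.

(** The maximum principle in each variable in turn. *)
Lemma quartic_tridisc (a b c : C) : normc a < 1 -> normc b < 1 -> normc c < 1 ->
  normc (quartic (elem1 a b c) (elem2 a b c)) <= 37 / 25.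
Proof.
have dl (k l z : C) : differentiable (fun z : C => k + z * l) z.
  apply: differentiable_add; first exact: differentiable_const.
  apply: differentiable_mul; first exact: differentiable_idC.
  exact: differentiable_const.
have dq x1 x2 x3 x4 (z : C) : differentiable (fun z : C => quartic (x1 + z * x2) (x3 + z * x4)) z.
  by apply: differentiable_quartic; exact: dl.
have d1 (u v z : C) : differentiable (fun z : C => quartic (elem1 z u v) (elem2 z u v)) z.
  rewrite (_ : (fun z => _) = (fun z : C => quartic (u + v + z * 1) (u * v + z * (u + v)))).
    exact: dq.
  by apply/funext => w; congr quartic; rewrite /elem1 /elem2; ring.
have sym1 (u v w : C) : elem1 u v w = elem1 v w u by rewrite /elem1; ring.
have sym2 (u v w : C) : elem2 u v w = elem2 v w u by rewrite /elem2; ring.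
move=> a1 b1 c1.
apply: (@max_modulus_disc R (fun z => quartic (elem1 z b c) (elem2 z b c)) _ (d1 b c) _ a a1) => a' a1'.
rewrite sym1 sym2.
apply: (@max_modulus_disc R (fun z => quartic (elem1 z c a') (elem2 z c a')) _ (d1 c a') _ b b1) => b' b1'.
rewrite sym1 sym2.
apply: (@max_modulus_disc R (fun z => quartic (elem1 z a' b') (elem2 z a' b')) _ (d1 a' b') _ c c1) => c' c1'.
exact: quartic_torus.
Qed.

End Torus.

(** * Coordinates of the symmetrized tridisc *)

Section Tridisc.
Context {R : realType}.
Local Notation C := R[i].
Local Notation V := 'rV[C]_3.
Local Notation i0 := (0 : 'I_3).
Local Notation i1 := (1 : 'I_3).
Local Notation i2 := (2 : 'I_3).
Local Notation G3 := (@symm_tridisc R).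

Lemma vec3E (x y z : C) :
  [/\ vec3 x y z 0 i0 = x, vec3 x y z 0 i1 = y & vec3 x y z 0 i2 = z].
Proof. by split; rewrite mxE. Qed.

Lemma vec3_0 : vec3 0 0 0 = 0 :> V.
Proof. by apply/rowP => j; rewrite !mxE; case: j => -[|[|[|//]]]. Qed.

Lemma differentiable_coordinate (j : 'I_3) (S : V) : differentiable (fun S : V => S 0 j) S.
Proof. exact: differentiable_coord. Qed.

Lemma differentiable_vec3 (f g h : C -> C) (z : C) :
  differentiable f z -> differentiable g z -> differentiable h z ->
  differentiable (fun w : C => vec3 (f w) (g w) (h w)) z.
Proof.
move=> df dg dh.
rewrite (_ : (fun w => _) =
  (fun w => f w *: vec3 1 0 0) + (fun w => g w *: vec3 0 1 0) + (fun w => h w *: vec3 0 0 1)).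
  apply: differentiableD; [apply: differentiableD|].
  - exact: differentiableZl.
  - exact: differentiableZl.
  - exact: differentiableZl.
apply/funext => w; apply/rowP => j; rewrite !mxE /=.
by case: j => -[|[|[|//]]] _ /=; ring.
Qed.

Lemma differentiable_curve_coord (phi : C -> V) (z : C) (j : 'I_3) :
  differentiable phi z -> differentiable (fun w : C => phi w 0 j) z.
Proof.
move=> dp; exact: (@differentiable_comp _ _ _ _ phi (fun S : V => S 0 j) z dp
  (differentiable_coordinate j _)).
Qed.

Lemma derive_curve_coord (phi : C -> V) (z : C) (j : 'I_3) :
  differentiable phi z -> ('D_1 phi z) 0 j = 'D_1 (fun w : C => phi w 0 j) z.
Proof.
move=> /derivable1_diffP dp; apply/esym/cvg_lim; first exact: norm_hausdorff.
have H := @cvg_comp _ _ _ (fun h : C => h^-1 *: ((phi \o shift z) (h *: 1) - phi z))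
  (fun S : V => S 0 j) _ _ _ dp (@coord_continuous _ _ _ 0 j _).
have -> : (fun h : C => h^-1 *: (((fun w : C => phi w 0 j) \o shift z) (h *: 1) - phi z 0 j)) =
  (fun S : V => S 0 j) \o (fun h : C => h^-1 *: ((phi \o shift z) (h *: 1) - phi z)).
  by apply/funext => h; rewrite /= !mxE.
exact: H.
Qed.

(** Reduces a differential to a derivative in one variable. *)
Lemma diff_along (f : V -> C) (X : V) : differentiable f 0 ->
  'd f 0 X = 'D_1 (fun w : C => f (w *: X)) 0.
Proof.
move=> df; rewrite -(deriveE X df) /derive.
have -> : (fun h : C => h^-1 *: ((f \o shift 0) (h *: X) - f 0)) =
  (fun h : C => h^-1 *: (((fun w : C => f (w *: X)) \o shift 0) (h *: 1) - f (0 *: X))).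
  by apply/funext => h; rewrite /= !addr0 scale0r [h *: 1]mulr1.
by [].
Qed.

Lemma symm_tridisc_coord (S : V) (j : 'I_3) : G3 S -> normc (S 0 j) <= 3.
Proof.
move=> [a [b [c [a1 b1 c1 ->]]]].
have m2 (x y : C) : unit_disc x -> unit_disc y -> normc (x * y) <= 1.
  by move=> x1 y1; rewrite normcM mulr_ile1 ?normc_ge0// ltW.
have a1' := ltW a1; have b1' := ltW b1; have c1' := ltW c1.
rewrite mxE; case: j => -[|[|[|//]]] _ /=.
- have := normcD_le (a + b) c; have := normcD_le a b; lra.
- have := normcD_le (a * b + b * c) (c * a); have := normcD_le (a * b) (b * c).
  have := m2 _ _ a1 b1; have := m2 _ _ b1 c1; have := m2 _ _ c1 a1; lra.
- rewrite normcM; have := m2 _ _ a1 b1 => ab.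
  apply: (@le_trans _ _ 1); last lra.
  by rewrite mulr_ile1 ?normc_ge0.
Qed.

(** The roots of u^3 - x u^2 + y u - z satisfy |u|^3 <= (|u|^2 + |u| + 1)/4,
    so they lie in the unit disc. *)
Lemma small_symm_tridisc (x y z : C) :
  normc x <= 1 / 4 -> normc y <= 1 / 4 -> normc z <= 1 / 4 -> G3 (vec3 x y z).
Proof.
move=> x4 y4 z4.
pose p : {poly C} := 'X^3 - x%:P * 'X^2 + y%:P * 'X - z%:P.
have sp : size p = 4%N.
  rewrite /p -addrA -addrA size_polyDl size_polyXn//.
  apply: leq_ltn_trans (size_polyD _ _) _; rewrite gtn_max; apply/andP; split.
    rewrite size_polyN; apply: leq_ltn_trans (size_polyMleq _ _) _.
    by rewrite size_polyXn size_polyC; case: (x != 0).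
  apply: leq_ltn_trans (size_polyD _ _) _; rewrite gtn_max size_polyN; apply/andP; split.
    apply: leq_ltn_trans (size_polyMleq _ _) _.
    by rewrite size_polyX size_polyC; case: (y != 0).
  by rewrite size_polyC; case: (z != 0).
have lp : lead_coef p = 1.
  by rewrite lead_coefE sp /p !(coefE, coefXn, coefC, coefCM, coefD, coefB, coefN) /= !mulr0 !subr0 addr0.
have [rs] := closed_field_poly_normal p.
rewrite lp scale1r => prs.
have : size rs = 3%N.
  by have := size_prod_XsubC rs id; rewrite -prs sp => -[].
case: rs prs => [//|a [//|b [//|c [|//]]]] prs _.
have root (u : C) : (u == a) || (u == b) || (u == c) -> u ^+ 3 = x * u ^+ 2 - y * u + z.
  move=> hu; have : p.[u] = 0.
    rewrite prs !big_cons big_nil !hornerE; move: hu.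
    by rewrite /=; case/orP => [/orP[]|] /eqP ->; ring.
  by rewrite /p !hornerE => h; apply/eqP; rewrite -subr_eq0 -h; apply/eqP; ring.
have disc (u : C) : (u == a) || (u == b) || (u == c) -> unit_disc u.
  move=> /root hu; rewrite /unit_disc /= ltNge; apply/negP => u1.
  have : normc u ^+ 3 <= 1 / 4 * normc u ^+ 2 + 1 / 4 * normc u + 1 / 4.
    rewrite -normcX hu; have := normcD_le (x * u ^+ 2 - y * u) z.
    have := normcB_le (x * u ^+ 2) (y * u).
    rewrite (normcM x) (normcM y) normcX.
    have : normc x * normc u ^+ 2 <= 1 / 4 * normc u ^+ 2.
      by apply: ler_wpM2r => //; exact: sqr_ge0.
    have : normc y * normc u <= 1 / 4 * normc u.
      by apply: ler_wpM2r => //; exact: normc_ge0.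
    lra.
  have : normc u ^+ 2 <= normc u ^+ 3 by rewrite ler_weXn2l.
  have : 1 * normc u <= normc u * normc u by apply: ler_wpM2r => //; exact: normc_ge0.
  rewrite -expr2; lra.
exists a, b, c; split; [by apply: disc; rewrite eqxx|by apply: disc; rewrite eqxx orbT|by apply: disc; rewrite eqxx orbT|].
have cf k : p`_k = (('X - a%:P) * (('X - b%:P) * ('X - c%:P)))`_k.
  by rewrite prs !big_cons big_nil mulr1.
have E : ('X - a%:P) * (('X - b%:P) * ('X - c%:P)) =
   'X^3 - (a + b + c)%:P * 'X^2 + (a * b + b * c + c * a)%:P * 'X - (a * b * c)%:P.
  by rewrite !rmorphD !rmorphM /=; ring.
have := cf 0%N; have := cf 1%N; have := cf 2%N; rewrite E /p.
rewrite !(coefD, coefB, coefN, coefCM, coefXn, coefX, coefC) /= !(mulr0, mulr1, subr0, add0r, addr0, sub0r).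
by rewrite !oppr0 !add0r => /oppr_inj -> -> /oppr_inj ->.
Qed.

End Tridisc.

(** * Holomorphic functions and discs *)

Section Bounds.
Context {R : realType}.
Local Notation C := R[i].
Local Notation V := 'rV[C]_3.
Local Notation i0 := (0 : 'I_3).
Local Notation i1 := (1 : 'I_3).
Local Notation i2 := (2 : 'I_3).
Local Notation G3 := (@symm_tridisc R).

Lemma slice_differentiable (f : V -> C) (p q r : C -> C) (w : C) :
  holo G3 unit_disc f -> differentiable p w -> differentiable q w ->
  differentiable r w -> G3 (vec3 (p w) (q w) (r w)) ->
  differentiable (fun z : C => f (vec3 (p z) (q z) (r z))) w.
Proof.
move=> hf dp dq dr Gw.
exact: (@differentiable_comp _ _ _ _ (fun z : C => vec3 (p z) (q z) (r z)) f w
  (differentiable_vec3 dp dq dr) (hf _ Gw).1).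
Qed.

(** Strict differentiability at 0 in the second coordinate.  Each slice of [f]
    is bounded and holomorphic on a disc of radius 1/4, hence Lipschitz.  The
    function y |-> f(x,y,0) - f(0,y,0) is O(x), therefore Lipschitz with
    constant O(x); this moves the increment in y from the line over x to the
    line over 0, where the derivative of [f] at 0 describes it. *)
Lemma slice_increment (f : V -> C) : holo G3 unit_disc f ->
  forall e, 0 < e -> exists2 d, 0 < d & forall x y y' z z' : C,
    normc x < d -> normc y < d -> normc y' < d -> normc z < d -> normc z' < d ->
    normc (f (vec3 x y z) - f (vec3 x y' z') - 'd f 0 (vec3 0 1 0) * (y - y')) <=
    16 * (normc z + normc z') + 256 * normc x * normc (y - y') + e * (normc y + normc y').
Proof.
move=> hf e e0.
have f1 x y z : normc x <= 1 / 4 -> normc y <= 1 / 4 -> normc z <= 1 / 4 ->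
    normc (f (vec3 x y z)) <= 1.
  by move=> hx hy hz; apply: ltW; exact: (hf _ (small_symm_tridisc hx hy hz)).2.
have q0 : 0 < 1 / 4 :> R by lra.
have c8 : 1 / 4 / 2 = 1 / 8 :> R by lra.
have n0 : normc (0 : C) <= 1 / 4 by rewrite normc0 ltW.
have k16 : 4 * 1 / (1 / 4) = 16 :> R by lra.
have lipz x y z : normc x <= 1 / 4 -> normc y <= 1 / 4 -> normc z <= 1 / 8 ->
    normc (f (vec3 x y z) - f (vec3 x y 0)) <= 16 * normc z.
  move=> hx hy hz.
  have dg w : normc w <= 1 / 4 -> differentiable (fun w : C => f (vec3 x y w)) w.
    move=> hw; apply: (@slice_differentiable f (fun _ => x) (fun _ => y) (fun w => w) w hf).
    - exact: differentiable_const.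
    - exact: differentiable_const.
    - exact: differentiable_idC.
    - exact: small_symm_tridisc.
  have := @bounded_lipschitz R _ (1 / 4) 1 q0 dg (fun w => @f1 x y w hx hy) z 0.
  by rewrite subr0 k16 c8; apply => //; rewrite normc0; lra.
have lipx x y : normc x <= 1 / 8 -> normc y <= 1 / 4 ->
    normc (f (vec3 x y 0) - f (vec3 0 y 0)) <= 16 * normc x.
  move=> hx hy.
  have dg w : normc w <= 1 / 4 -> differentiable (fun w : C => f (vec3 w y 0)) w.
    move=> hw; apply: (@slice_differentiable f (fun w => w) (fun _ => y) (fun _ => 0) w hf).
    - exact: differentiable_idC.
    - exact: differentiable_const.
    - exact: differentiable_const.
    - exact: small_symm_tridisc.
  have := @bounded_lipschitz R _ (1 / 4) 1 q0 dg (fun w hw => @f1 w y 0 hw hy n0) x 0.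
  by rewrite subr0 k16 c8; apply => //; rewrite normc0; lra.
have dgy x w : normc x <= 1 / 4 -> normc w <= 1 / 4 ->
    differentiable (fun w : C => f (vec3 x w 0)) w.
  move=> hx hw; apply: (@slice_differentiable f (fun _ => x) (fun w => w) (fun _ => 0) w hf).
  - exact: differentiable_const.
  - exact: differentiable_idC.
  - exact: differentiable_const.
  - exact: small_symm_tridisc.
have lipy x y y' : normc x <= 1 / 8 -> normc y <= 1 / 8 -> normc y' <= 1 / 8 ->
    normc ((f (vec3 x y 0) - f (vec3 0 y 0)) - (f (vec3 x y' 0) - f (vec3 0 y' 0)))
    <= 256 * normc x * normc (y - y').
  move=> hx hy hy'; have hx4 : normc x <= 1 / 4 by lra.
  have dg w : normc w <= 1 / 4 ->
      differentiable (fun w : C => f (vec3 x w 0) - f (vec3 0 w 0)) w.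
    by move=> hw; apply: differentiable_sub; exact: dgy.
  have := @bounded_lipschitz R _ (1 / 4) (16 * normc x) q0 dg
    (fun w hw => lipx x w hx hw) y y'.
  have -> : 4 * (16 * normc x) / (1 / 4) = 256 * normc x by lra.
  by rewrite c8; apply.
have df0 : differentiable f 0.
  by rewrite -vec3_0; apply: (hf _ _).1; apply: small_symm_tridisc.
have dE : 'd f 0 (vec3 0 1 0) = 'D_1 (fun w : C => f (vec3 0 w 0)) 0.
  rewrite (diff_along _ df0).
  have -> // : (fun w : C => f (w *: (vec3 0 1 0 : V))) = (fun w : C => f (vec3 0 w 0)).
  apply/funext => w; congr f.
  by apply/rowP => j; rewrite !mxE; case: j => -[|[|[|//]]] _ /=; rewrite ?mulr0 ?mulr1.
have [d d0 hd] := differentiable_cdiff (dgy 0 0 n0 n0) e0.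
exists (Num.min d (1 / 8)); first by rewrite lt_min d0; lra.
move=> x y y' z z'; rewrite !lt_min.
move=> /andP[_ hx] /andP[yd hy] /andP[yd' hy'] /andP[_ hz] /andP[_ hz'].
have h1 := lipz x y z ltac:(lra) ltac:(lra) (ltW hz).
have h2 := lipz x y' z' ltac:(lra) ltac:(lra) (ltW hz').
have h3 := lipy x y y' (ltW hx) (ltW hy) (ltW hy').
have := hd y; rewrite subr0 => /(_ yd); have := hd y'; rewrite subr0 => /(_ yd').
rewrite dE; set D := 'D_1 (fun w : C => f (vec3 0 w 0)) 0 => h5 h4.
set A := _ - _ in h1; set B := _ - _ in h2; set X := _ - _ in h3.
set E1 := _ - _ in h4; set E2 := _ - _ in h5.
have -> : f (vec3 x y z) - f (vec3 x y' z') - D * (y - y') = A - B + X + (E1 - E2).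
  by rewrite /A /B /X /E1 /E2; ring.
have := normcD_le (A - B + X) (E1 - E2); have := normcD_le (A - B) X.
have := normcB_le A B; have := normcB_le E1 E2; lra.
Qed.

(** With the same s1 on both curves, the difference
    f(l s1, l^2 s2, l^3 s3) - f(l s1, l^2 s2', l^3 s3') is
    f'(0)e2 (s2 - s2') l^2 + o(l^2), and it is bounded by 2 on the disc. *)
Lemma derivative_e2_bound (f : V -> C) (a b c a' b' c' : C) :
  holo G3 unit_disc f -> unit_disc a -> unit_disc b -> unit_disc c ->
  unit_disc a' -> unit_disc b' -> unit_disc c' -> elem1 a b c = elem1 a' b' c' ->
  normc ('d f 0 (vec3 0 1 0)) * normc (elem2 a b c - elem2 a' b' c') <= 2.
Proof.
move=> hf a1 b1 c1 a1' b1' c1' ss.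
pose pt (a b c l : C) : V := vec3 (l * elem1 a b c) (l ^+ 2 * elem2 a b c) (l ^+ 3 * elem3 a b c).
have G x y z l : unit_disc x -> unit_disc y -> unit_disc z -> normc l <= 1 -> G3 (pt x y z l).
  have m (u : C) : unit_disc u -> normc l <= 1 -> unit_disc (l * u).
    move=> u1 l1; rewrite /unit_disc /= normcM; apply: le_lt_trans u1.
    by rewrite ler_piMl ?normc_ge0.
  move=> ua ub uc l1; exists (l * x), (l * y), (l * z); split; [exact: m|exact: m|exact: m|].
  by rewrite /pt /elem1 /elem2 /elem3; congr vec3; ring.
have dpt x y z l : unit_disc x -> unit_disc y -> unit_disc z -> normc l <= 1 ->
    differentiable (fun l : C => f (pt x y z l)) l.
  move=> ua ub uc l1; apply: slice_differentiable hf _ _ _ _.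
  - by apply: differentiable_mul; [exact: differentiable_idC|exact: differentiable_const].
  - apply: differentiable_mul; last exact: differentiable_const.
    by apply: differentiable_pow; exact: differentiable_idC.
  - apply: differentiable_mul; last exact: differentiable_const.
    by apply: differentiable_pow; exact: differentiable_idC.
  - exact: G.
rewrite -normcM; set bs := _ * _.
(* both curves stay in the domain for |l| <= 1, as the triples are in the open tridisc *)
suff : normc bs * 1 ^+ 2 <= 2 by rewrite expr1n mulr1.
apply: (@taylor_coef_bound R (fun l => f (pt a b c l) - f (pt a' b' c' l))); first exact: ltr01.
- by move=> l l1; apply: differentiable_sub; exact: dpt.
- move=> l l1; have l1' : normc l <= 1 by rewrite l1.
  have h1 := (hf _ (G a b c l a1 b1 c1 l1')).2.
  have h2 := (hf _ (G a' b' c' l a1' b1' c1' l1')).2.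
  rewrite /unit_disc /= in h1 h2.
  apply: le_trans (normcB_le _ _) _; lra.
move=> e e0.
have n3 (x y z : C) : unit_disc x -> unit_disc y -> unit_disc z ->
    [/\ normc (elem1 x y z) <= 3, normc (elem2 x y z) <= 3 & normc (elem3 x y z) <= 3].
  move=> x1 y1 z1; have g : G3 (vec3 (elem1 x y z) (elem2 x y z) (elem3 x y z)) by exists x, y, z.
  have := symm_tridisc_coord i0 g; have := symm_tridisc_coord i1 g.
  by have := symm_tridisc_coord i2 g; rewrite !mxE.
have [S1 S2 S3] := n3 a b c a1 b1 c1; have [_ S2' S3'] := n3 a' b' c' a1' b1' c1'.
have e6 : 0 < e / 12 by rewrite divr_gt0.
have [d d0 hd] := slice_increment hf e6.
exists (Num.min (Num.min 1 (d / 3)) (e / 100 / 100)).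
  by rewrite !lt_min ltr01 /=; apply/andP; split; lra.
move=> l; rewrite !lt_min => /andP[/andP[l1 ld] le].
set n := normc l in l1 ld le *.
have n0 : 0 <= n by exact: normc_ge0.
have nX k (u : C) : normc u <= 3 -> normc (l ^+ k.+1 * u) <= 3 * n ^+ k.+1.
  by move=> u3; rewrite normcM normcX mulrC ler_pM// ?normc_ge0// exprn_ge0.
have nd k (u : C) : normc u <= 3 -> normc (l ^+ k.+1 * u) < d.
  move=> u3; apply: le_lt_trans (nX k u u3) _.
  have : n ^+ k.+1 <= n by rewrite exprS ler_piMr// exprn_ile1// ltW.
  lra.
have := hd (l ^+ 1 * elem1 a b c) (l ^+ 2 * elem2 a b c) (l ^+ 2 * elem2 a' b' c')
  (l ^+ 3 * elem3 a b c) (l ^+ 3 * elem3 a' b' c')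
  (nd 0%N _ S1) (nd 1%N _ S2) (nd 1%N _ S2') (nd 2%N _ S3) (nd 2%N _ S3').
rewrite /pt -ss !expr1.
have -> : 'd f 0 (vec3 0 1 0) * (l ^+ 2 * elem2 a b c - l ^+ 2 * elem2 a' b' c') =
  bs * l ^+ 2 by rewrite /bs; ring.
move=> h; apply: le_trans h _.
have N1 := nX 0%N _ S1; have N2 := nX 1%N _ S2; have N2' := nX 1%N _ S2'.
have N3 := nX 2%N _ S3; have N3' := nX 2%N _ S3'; rewrite !expr1 in N1.
have N4 : normc (l * elem1 a b c) * normc (l ^+ 2 * elem2 a b c - l ^+ 2 * elem2 a' b' c') <=
    (3 * n) * (6 * n ^+ 2).
  apply: ler_pM; [exact: normc_ge0|exact: normc_ge0|exact: N1|].
  apply: le_trans (normcB_le _ _) _; lra.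
have N5 : n ^+ 2 * n <= n ^+ 2 * (e / 100 / 100).
  by apply: ler_wpM2l; [exact: sqr_ge0|exact: ltW].
have N6 : e / 12 * (normc (l ^+ 2 * elem2 a b c) + normc (l ^+ 2 * elem2 a' b' c')) <=
   e / 12 * (6 * n ^+ 2).
  by apply: ler_wpM2l; [exact: ltW|lra].
have en : 0 <= n ^+ 2 * e by rewrite mulr_ge0 ?sqr_ge0// ltW.
lra.
Qed.

(** The triple (a, a, c) and its conjugate, with 2a + c real.  The numbers
    approximate, with common denominator 162 and from inside the disc, the
    unimodular triple that maximizes |Im s2|. *)
Lemma derivative_e2_le (f : V -> C) : holo G3 unit_disc f ->
  normc ('d f 0 (vec3 0 1 0)) <= 82 / 100 + 12 / 100 / 100.
Proof.
move=> hf.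
pose a : C := (147 / 162) +i* (68 / 162); pose c : C := (- (88 / 162)) +i* (- (136 / 162)).
have ud (x y : R) : x ^+ 2 + y ^+ 2 < 1 -> unit_disc (x +i* y).
  move=> h; rewrite /unit_disc /= -[X in _ < X]sqrtr1 ltr_sqrt//.
have a1 : unit_disc a by apply: ud; lra.
have c1 : unit_disc c by apply: ud; lra.
have cj (z : C) : unit_disc z -> unit_disc (conjc z) by rewrite /unit_disc /= normc_conj.
have a1' := cj _ a1; have c1' := cj _ c1.
have ss : elem1 a a c = elem1 (conjc a) (conjc a) (conjc c).
  by apply/eqP; rewrite eq_complex /=; apply/andP; split; apply/eqP; lra.
have := derivative_e2_bound hf a1 a1 c1 a1' a1' c1' ss.
have -> : elem2 a a c - elem2 (conjc a) (conjc a) (conjc c) = 0 +i* (- (2 * (34 * 940 / (162 * 162)))).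
  by apply/eqP; rewrite eq_complex /=; apply/andP; split; apply/eqP; lra.
have im (u : R) : 0 <= u -> normc (0 +i* (- u)) = u.
  by move=> u0; rewrite /normc expr0n add0r sqrtr_sqr normrN ger0_norm.
rewrite im; last by lra.
by have := normc_ge0 ('d f 0 (vec3 0 1 0)); lra.
Qed.

Lemma normc_quartic_b : normc (quartic_b%:C : C) <= 1.
Proof. by rewrite normc_real /quartic_b normrN ger0_norm; lra. Qed.

Lemma normc_quartic_c : normc (quartic_c%:C : C) <= 1.
Proof. by rewrite normc_real /quartic_c ger0_norm; lra. Qed.

(** Along a curve through 0 the first coordinate enters with total degree at
    least 3, so that only the square of the second one contributes to the
    order 2. *)
Lemma quartic_jet (a b : C -> C) : differentiable a 0 -> differentiable b 0 ->
  a 0 = 0 -> b 0 = 0 ->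
  forall e, 0 < e -> exists2 d, 0 < d & forall z, normc z < d ->
    normc (quartic (a z) (b z) - ('D_1 b 0) ^+ 2 * z ^+ 2) <= e * normc z ^+ 2.
Proof.
move=> /differentiable_cdiff da /differentiable_cdiff db a0 b0 e e0.
move: ('D_1 a 0) ('D_1 b 0) da db => Da Db da db.
pose N := normc Da + normc Db + 1.
have [nA nB] := (normc_ge0 Da, normc_ge0 Db).
have N1 : 1 <= N by rewrite /N; lra.
have N0 : 0 < N by lra.
pose e1 := Num.min 1 (e / 8 / N).
have e10 : 0 < e1 by rewrite lt_min ltr01 !divr_gt0.
have e11 : e1 <= 1 by rewrite ge_min lexx.
have e12 : e1 * N <= e / 8 by rewrite -ler_pdivlMr// ge_min lexx orbT.
have [d1 d10 h1] := da 1 ltr01; have [d2 d20 h2] := db e1 e10.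
have N4 : 0 < N ^+ 4 by exact: exprn_gt0.
exists (Num.min (Num.min d1 d2) (Num.min 1 (e / 4 / N ^+ 4))).
  by rewrite !lt_min d10 d20 ltr01 !divr_gt0.
move=> z; rewrite !lt_min ltr_pdivlMr// => /andP[/andP[z1 z2] /andP[z3 z4]].
have := h1 z; rewrite subr0 a0 subr0 mul1r => /(_ z1) ra.
have := h2 z; rewrite subr0 b0 subr0 => /(_ z2) rb.
set n := normc z in z1 z2 z3 z4 ra rb *.
have n0 : 0 <= n by exact: normc_ge0.
have na : normc (a z) <= N * n.
  have := normcD_le (a z - Da * z) (Da * z); rewrite subrK normcM -/n.
  have : 0 <= normc Db * n by exact: mulr_ge0.
  rewrite /N; lra.
have e1n : e1 * n <= n by rewrite ler_piMl.
have nb : normc (b z) <= N * n.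
  have := normcD_le (b z - Db * z) (Db * z); rewrite subrK normcM -/n.
  have : 0 <= normc Da * n by exact: mulr_ge0.
  rewrite /N; lra.
have nDb : normc (Db * z) <= N * n.
  by rewrite normcM ler_wpM2r// /N; lra.
have -> : quartic (a z) (b z) - Db ^+ 2 * z ^+ 2 =
  (b z - Db * z) * (b z + Db * z) + quartic_b%:C * a z ^+ 2 * b z + quartic_c%:C * a z ^+ 4.
  by rewrite /quartic; ring.
have Nn0 : 0 <= N * n by rewrite mulr_ge0// ltW.
have t1 : normc ((b z - Db * z) * (b z + Db * z)) <= e1 * n * (2 * (N * n)).
  rewrite normcM; apply: ler_pM; [exact: normc_ge0|exact: normc_ge0|exact: rb|].
  apply: le_trans (normcD_le _ _) _; lra.
have t2 : normc (quartic_b%:C * a z ^+ 2 * b z) <= 1 * (N * n) ^+ 2 * (N * n).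
  rewrite 2!normcM normcX; apply: ler_pM; [|exact: normc_ge0| |exact: nb].
    by apply: mulr_ge0; [exact: normc_ge0|exact: sqr_ge0].
  apply: ler_pM; [exact: normc_ge0|exact: sqr_ge0|exact: normc_quartic_b|].
  by apply: lerXn2r; rewrite ?nnegrE ?normc_ge0.
have t3 : normc (quartic_c%:C * a z ^+ 4) <= 1 * (N * n) ^+ 4.
  rewrite normcM normcX; apply: ler_pM; [exact: normc_ge0|by apply: exprn_ge0; exact: normc_ge0|exact: normc_quartic_c|].
  by apply: lerXn2r; rewrite ?nnegrE ?normc_ge0.
have n2 : 0 <= n ^+ 2 by exact: sqr_ge0.
have t1' : e1 * n * (2 * (N * n)) <= e / 4 * n ^+ 2.
  have -> : e1 * n * (2 * (N * n)) = 2 * (e1 * N) * n ^+ 2 by ring.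
  by apply: ler_wpM2r => //; lra.
have N4n : n * N ^+ 4 <= e / 4 by exact: ltW.
have t3' : 1 * (N * n) ^+ 4 <= e / 4 * n ^+ 2.
  have -> : 1 * (N * n) ^+ 4 = n * (n * N ^+ 4) * n ^+ 2 by ring.
  apply: ler_wpM2r => //; apply: le_trans N4n.
  by apply: ler_piMl; [rewrite mulr_ge0// ltW|exact: ltW].
have t2' : 1 * (N * n) ^+ 2 * (N * n) <= e / 4 * n ^+ 2.
  have -> : 1 * (N * n) ^+ 2 * (N * n) = n * N ^+ 3 * n ^+ 2 by ring.
  apply: ler_wpM2r => //; apply: le_trans N4n; apply: ler_wpM2l => //.
  by apply: ler_weXn2l.
apply: le_trans (normcD_le _ _) _.
have := normcD_le ((b z - Db * z) * (b z + Db * z)) (quartic_b%:C * a z ^+ 2 * b z).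
have : 0 <= e * n ^+ 2 by rewrite mulr_ge0// ltW.
lra.
Qed.

(** Allows discs centred near 0 instead of at 0; the constant is far from
    sharp. *)
Lemma quartic_shift (X Y x y : C) (h : R) : normc X <= 3 -> normc Y <= 3 ->
  normc x <= h -> normc y <= h -> h <= 1 ->
  normc (quartic (X - x) (Y - y)) <= normc (quartic X Y) + 219 * h.
Proof.
move=> X3 Y3 xh yh h1.
have h0 : 0 <= h by exact: le_trans (normc_ge0 x) xh.
have X4 : normc (X - x) <= 4 by have := normcB_le X x; lra.
have Y4 : normc (Y - y) <= 4 by have := normcB_le Y y; lra.
have P (u v : C) (k l : R) : normc u <= k -> normc v <= l -> normc (u * v) <= k * l.
  by move=> uk vl; rewrite normcM; apply: ler_pM => //; exact: normc_ge0.
have -> : quartic (X - x) (Y - y) = quartic X Y + (y * (y - 2 * Y)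
  + (quartic_b%:C * (x * (x - 2 * X) * (Y - y) - X * X * y)
  + quartic_c%:C * (x * (x - 2 * X) * ((X - x) * (X - x) + X * X)))).
  by rewrite /quartic; ring.
have q (u U : C) : normc u <= h -> normc U <= 3 -> normc (u * (u - 2 * U)) <= h * 7.
  move=> uh U3; apply: P => //; apply: le_trans (normcB_le _ _) _.
  rewrite normcM normc2; lra.
have t1 := q y Y yh Y3; have t2 := q x X xh X3.
have t3 := P _ _ _ _ t2 Y4.
have t4 := P _ _ _ _ (P _ _ _ _ X3 X3) yh.
have t5 : normc ((X - x) * (X - x) + X * X) <= 25.
  have := normcD_le ((X - x) * (X - x)) (X * X); have := P _ _ _ _ X4 X4.
  have := P _ _ _ _ X3 X3; lra.
have t6 := P _ _ _ _ t2 t5.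
have t7 : normc (x * (x - 2 * X) * (Y - y) - X * X * y) <= h * 37.
  apply: le_trans (normcB_le _ _) _; lra.
have t8 := P _ _ _ _ normc_quartic_b t7.
have t9 := P _ _ _ _ normc_quartic_c t6.
apply: le_trans (normcD_le _ _) _; rewrite lerD2l.
apply: le_trans (normcD_le _ _) _.
have := normcD_le (quartic_b%:C * (x * (x - 2 * X) * (Y - y) - X * X * y))
  (quartic_c%:C * (x * (x - 2 * X) * ((X - x) * (X - x) + X * X))).
lra.
Qed.

Lemma le_of_shrink (a M : R) : 0 <= M -> (forall r, 0 < r < 1 -> a * r ^+ 2 <= M) -> a <= M.
Proof.
move=> M0 H; rewrite leNgt; apply/negP => Ma.
have a0 : 0 < a by exact: le_lt_trans Ma.
pose q := M / a.
have q1 : q < 1 by rewrite /q ltr_pdivrMr// mul1r.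
have q0 : 0 <= q by rewrite /q divr_ge0// ltW.
have := H ((1 + q) / 2).
have -> : M = a * q by rewrite /q mulrC divfK// gt_eqF.
rewrite ler_pM2l// => h.
have {}h := h ltac:(lra).
have : 0 < (1 - q) ^+ 2 by rewrite exprn_gt0// subr_gt0.
have : ((1 + q) / 2) ^+ 2 - q = (1 - q) ^+ 2 / 4 by field.
lra.
Qed.

Lemma quartic_symm_tridisc (S : V) : G3 S -> normc (quartic (S 0 i0) (S 0 i1)) <= 37 / 25.
Proof.
move=> [a [b [c [a1 b1 c1 ->]]]]; rewrite !mxE /=; exact: quartic_tridisc.
Qed.

(** Compose [quartic] with the disc, translated to start at 0.  The result
    is v^2 z^2 + o(z^2), where v is the speed in the second coordinate, and
    its modulus is at most 37/25 plus the cost of the translation. *)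
Lemma disc_speed_bound (phi : C -> V) (h : R) : holo unit_disc G3 phi ->
  (forall j, normc (phi 0 0 j) <= h) -> h <= 1 ->
  normc ('D_1 (fun z : C => phi z 0 i1) 0) ^+ 2 <= 37 / 25 + 219 * h.
Proof.
move=> hphi ph h1.
have h0 : 0 <= h by apply: le_trans (normc_ge0 _) (ph 0).
apply: le_of_shrink; first by lra.
move=> r /andP[r0 r1]; rewrite -normcX.
have n0 : normc (0 : C) < 1 by rewrite normc0.
have u0 : unit_disc (0 : C) by exact: n0.
have dj j (z : C) : unit_disc z -> differentiable (fun z : C => phi z 0 j - phi 0 0 j) z.
  move=> z1; apply: differentiable_sub; last exact: differentiable_const.
  by apply: differentiable_curve_coord; exact: (hphi z z1).1.
apply: (@taylor_coef_bound R (fun z : C => quartic (phi z 0 i0 - phi 0 0 i0) (phi z 0 i1 - phi 0 0 i1)));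
  first exact: r0.
- by move=> z zr; apply: differentiable_quartic; apply: dj; apply: le_lt_trans zr r1.
- move=> z zr; have z1 : unit_disc z by rewrite /unit_disc /= zr.
  have g := (hphi z z1).2.
  apply: le_trans (quartic_shift (symm_tridisc_coord i0 g) (symm_tridisc_coord i1 g) (ph _) (ph _) h1) _.
  by rewrite lerD2r; exact: quartic_symm_tridisc.
move=> e e0.
have := quartic_jet (dj i0 0 u0) (dj i1 0 u0) (subrr _) (subrr _) e0.
rewrite derive_sub; last exact: differentiable_const; last first.
  by apply: differentiable_curve_coord; exact: (hphi 0 u0).1.
have -> : 'D_1 (fun _ : C => phi 0 0 i1) 0 = 0 by exact: derive_cst.
by rewrite subr0.
Qed.

End Bounds.

(** * Iterated partial derivatives of polynomials at 0 *)

Section Monomials.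
Context {R : realType} {n : nat}.
Local Notation C := R[i].
Local Notation V := 'rV[C]_n.
Implicit Types (m a : 'I_n -> nat) (c : C) (S : V).

Definition monomial c m S : C := c * \prod_j S 0 j ^+ m j.

(** Directional derivatives are derivatives along a complex line, which
    brings in the calculus of one variable. *)
Lemma is_derive_line (f : V -> C) (v S : V) (D : C) :
  is_derive (0 : C) 1 (fun t : C => f (t *: v + S)) D -> is_derive S v f D.
Proof.
move=> [dv dE].
have E : (fun h : C => h^-1 *: (((fun t : C => f (t *: v + S)) \o shift 0) (h *: 1) - f (0 *: v + S))) =
  (fun h : C => h^-1 *: ((f \o shift S) (h *: v) - f S)).
  by apply/funext => h; rewrite /= addr0 scale0r add0r [h *: 1]mulr1.
split; first by rewrite /derivable -E.
by rewrite -dE /derive -E.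
Qed.

Lemma is_derive_monomial c m i S : is_derive S (delta_mx 0 i) (monomial c m)
  (monomial (c * (m i)%:R) (fun j => m j - (j == i))%N S).
Proof.
apply: is_derive_line.
pose K := c * \prod_(j | j != i) S 0 j ^+ m j.
rewrite (_ : (fun t : C => _) = (fun t : C => K * (t + S 0 i) ^+ m i)); last first.
  apply/funext => t; rewrite /monomial (bigD1 i)//= !mxE !eqxx mulr1 /K.
  rewrite -mulrA; congr (_ * _); rewrite mulrC; congr (_ * _).
  by apply: eq_bigr => j ji; rewrite !mxE (negPf ji) andbF mulr0 add0r.
have -> : monomial (c * (m i)%:R) (fun j => m j - (j == i))%N S =
    K * ((m i)%:R * S 0 i ^+ (m i).-1).
  rewrite /monomial (bigD1 i)//= eqxx subn1 /K.
  have -> : \prod_(j | j != i) S 0 j ^+ (m j - (j == i)) = \prod_(j | j != i) S 0 j ^+ m j.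
    by apply: eq_bigr => j /negPf ->; rewrite subn0.
  by ring.
apply/cdiff_is_derive.
set s := S 0 i; move: (m i) => k.
have dp : differentiable (fun t : C => (t + s) ^+ k) 0.
  apply: differentiable_pow; apply: differentiable_add; [exact: differentiable_idC|exact: differentiable_const].
have dk : 'D_1 (fun t : C => (t + s) ^+ k) 0 = k%:R * s ^+ k.-1.
  have h : is_derive (0 : C) 1 (fun t : C => t + s) 1.
    by apply: is_derive_eq; rewrite addr0.
  have := @is_deriveX _ _ (fun t : C => t + s) k 0 1 1 h.
  have -> : (fun t : C => t + s) ^+ k = (fun t : C => (t + s) ^+ k) by apply/funext => t; rewrite fctE.
  move=> [_ ->]; rewrite add0r [_ *: 1]mulr1 -mulr_natl.
  by [].
have := differentiable_cdiff dp; rewrite dk => hc e e0.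
have K1 : 0 < normc K + 1 by rewrite ltr_wpDl ?normc_ge0.
have [d d0 hd] := hc (e / (normc K + 1)) (divr_gt0 e0 K1).
exists d => // z /hd.
have -> : K * (z + s) ^+ k - K * (0 + s) ^+ k - K * (k%:R * s ^+ k.-1) * (z - 0) =
  K * ((z + s) ^+ k - (0 + s) ^+ k - k%:R * s ^+ k.-1 * (z - 0)) by ring.
move=> h; rewrite normcM.
apply: (@le_trans _ _ ((normc K + 1) * (e / (normc K + 1) * normc (z - 0)))).
  by apply: ler_pM => //; rewrite ?normc_ge0// lerDl.
by rewrite mulrA [_ * (e / _)]mulrC divfK// gt_eqF.
Qed.

Definition monomial_sum (l : seq (C * ('I_n -> nat))) S : C :=
  \sum_(p <- l) monomial p.1 p.2 S.

Definition dmonomial i (p : C * ('I_n -> nat)) :=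
  (p.1 * (p.2 i)%:R, fun j => (p.2 j - (j == i))%N).

Lemma derive_monomial_sum l i :
  (fun S => 'D_(delta_mx 0 i) (monomial_sum l) S) = monomial_sum (map (dmonomial i) l).
Proof.
apply/funext => S; suff [_ ->] : is_derive S (delta_mx 0 i) (monomial_sum l)
  (monomial_sum (map (dmonomial i) l) S) by [].
elim: l => [|p l IH].
  rewrite (_ : monomial_sum [::] = cst 0); last by apply/funext => T; rewrite /monomial_sum big_nil.
  by rewrite /=; exact: is_derive_cst.
rewrite (_ : monomial_sum (p :: l) = monomial p.1 p.2 + monomial_sum l); last first.
  by apply/funext => T; rewrite /monomial_sum big_cons.
rewrite /= /monomial_sum big_cons -/(monomial_sum _ S).
by apply: is_deriveD => //; exact: is_derive_monomial.
Qed.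

Lemma iter_dmonomial k i p : iter k (dmonomial i) p =
  (p.1 * (p.2 i ^_ k)%:R, fun j => (p.2 j - (j == i) * k)%N).
Proof.
elim: k => [|k IH]; first by case: p => c m /=; congr pair; [rewrite ffactn0 mulr1|apply/funext => j; rewrite muln0 subn0].
rewrite iterS IH /dmonomial /= eqxx mul1n; congr pair.
  by rewrite -mulrA -natrM ffactnSr.
by apply/funext => j; rewrite mulnSr subnDA.
Qed.

Lemma mpartial_monomial_sum a l :
  mpartial a (monomial_sum l) =
  monomial_sum (map (fun p => (p.1 * (\prod_i p.2 i ^_ a i)%:R, fun j => (p.2 j - a j)%N)) l).
Proof.
have it k i l' : iter k (fun h x => 'D_(delta_mx 0 i) h x) (monomial_sum l') =
    monomial_sum (map (iter k (dmonomial i)) l').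
  elim: k => [|k IH]; first by rewrite map_id.
  by rewrite iterS IH derive_monomial_sum -map_comp.
rewrite /mpartial.
have gen (s : seq 'I_n) : uniq s ->
   foldr (fun i g => iter (a i) (fun h x => 'D_(delta_mx 0 i) h x) g) (monomial_sum l) s =
   monomial_sum (map (fun p => (p.1 * (\prod_(i <- s) p.2 i ^_ a i)%:R,
     fun j => (p.2 j - (j \in s) * a j)%N)) l).
  elim: s => [_|i s IH /= /andP[si us]].
    rewrite /= -[in LHS](map_id l); congr monomial_sum; apply: eq_map => -[c m] /=.
    by rewrite big_nil mulr1; congr pair; apply/funext => j; rewrite subn0.
  rewrite IH// it -map_comp; congr monomial_sum; apply: eq_map => -[c m] /=.
  rewrite iter_dmonomial /= (negPf si) mul0n subn0 big_cons; congr pair.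
    by rewrite -mulrA -natrM mulnC.
  apply/funext => j; rewrite inE; have [->|ji] := eqVneq j i.
    by rewrite (negPf si) mul0n subn0.
  by rewrite mul0n subn0.
rewrite gen ?enum_uniq//; congr monomial_sum; apply: eq_map => -[c m] /=.
congr pair; first by rewrite big_enum.
by apply/funext => j; rewrite mem_enum mul1n.
Qed.

(** Only the monomial with exponent [a] survives at 0: a smaller exponent is
    killed by the falling factorial, a larger one by evaluation. *)
Lemma mpartial_monomial_sum_at0 a l : mpartial a (monomial_sum l) 0 =
  \sum_(p <- l) (if [forall i, p.2 i == a i] then p.1 * (\prod_i (a i)`!)%:R else 0).
Proof.
rewrite mpartial_monomial_sum /monomial_sum big_map; apply: eq_bigr => -[c m] _ /=.
rewrite /monomial; case: ifP => [/forallP h|/negbT].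
  rewrite [X in _ * X]big1 ?mulr1 => [|j _]; last by rewrite -(eqP (h j)) /= subnn expr0.
  congr (_ * _%:R); apply: eq_bigr => i _.
  by rewrite (eqP (h i)) ffactnn.
rewrite negb_forall => /existsP[i mi].
have [lt|ge] := ltnP (m i) (a i).
  by rewrite (bigD1 i)//= (ffact_small lt) mul0n mulr0 mul0r.
rewrite [X in _ * X](bigD1 i)//= mxE expr0n subn_eq0.
have -> : (m i <= a i)%N = false.
  by apply/negbTE; rewrite -ltnNge ltn_neqAle eq_sym mi.
by rewrite mul0r mulr0.
Qed.

End Monomials.

(** * Comparison of the metrics *)

Section Metrics.
Context {R : realType}.
Local Notation C := R[i].
Local Notation V := 'rV[C]_3.
Local Notation i0 := (0 : 'I_3).
Local Notation i1 := (1 : 'I_3).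
Local Notation G3 := (@symm_tridisc R).
Local Notation e2 := (vec3 0 1 0 : V).

(** The factor 27/40 is slightly below 25/37, so that the values stay
    strictly inside the unit disc. *)
Definition scaled_quartic (S : V) : C := (27 / 40 : R)%:C * quartic (S 0 i0) (S 0 i1).

Definition exponents (s : seq nat) (i : 'I_3) : nat := nth 0%N s i.

Lemma scaled_quartic_monomials : scaled_quartic = monomial_sum
  [:: ((27 / 40 : R)%:C, exponents [:: 0; 2; 0]%N);
      ((27 / 40 : R)%:C * quartic_b%:C, exponents [:: 2; 1; 0]%N);
      ((27 / 40 : R)%:C * quartic_c%:C, exponents [:: 4; 0; 0]%N)].
Proof.
apply/funext => S; rewrite /monomial_sum !big_cons big_nil /monomial /exponents /=.
rewrite !big_ord_recl !big_ord0 /= /bump /=.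
have -> : lift ord0 ord0 = i1 by apply: val_inj.
have -> : ord0 = i0 by apply: val_inj.
rewrite /scaled_quartic /quartic; ring.
Qed.

Lemma scaled_quartic_mpartial (a : 'I_3 -> nat) : (\sum_i a i <= 2)%N ->
  mpartial a scaled_quartic 0 =
  if [forall i, exponents [:: 0; 2; 0]%N i == a i] then (27 / 40 : R)%:C * (\prod_i (a i)`!)%:R else 0.
Proof.
move=> a2; rewrite scaled_quartic_monomials mpartial_monomial_sum_at0 !big_cons big_nil /=.
have no (s : seq nat) : (2 < \sum_(i < 3) nth 0 s i)%N -> [forall i, exponents s i == a i] = false.
  move=> s2; apply/negbTE/negP => /forallP h; move: a2; rewrite leqNgt; apply/negP/negPn.
  by rewrite -(eq_bigr _ (fun i _ => eqP (h i))).
rewrite (no [:: 2; 1; 0]%N) ?(no [:: 4; 0; 0]%N) ?addr0// !big_ord_recl big_ord0//.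
Qed.

Lemma scaled_quartic_holo : holo G3 unit_disc scaled_quartic.
Proof.
move=> S GS; split.
  apply: differentiable_mul; first exact: differentiable_const.
  by apply: differentiable_quartic; exact: differentiable_coordinate.
rewrite /unit_disc /= /scaled_quartic normcM normc_real ger0_norm; last by lra.
have := quartic_symm_tridisc GS; lra.
Qed.

Lemma scaled_quartic_ord : ord_ge 0 scaled_quartic 2.
Proof.
move=> a a2; rewrite scaled_quartic_mpartial; last exact: ltnW.
case: ifP => // /forallP h; move: a2.
rewrite -(eq_bigr _ (fun i _ => eqP (h i))) /exponents.
by rewrite !big_ord_recl big_ord0.
Qed.

Lemma scaled_quartic_taylor_form (X : V) :
  taylor_form 2 scaled_quartic 0 X = (27 / 40 : R)%:C * X 0 i1 ^+ 2.
Proof.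
rewrite /taylor_form.
pose a0 : {ffun 'I_3 -> 'I_3} := [ffun i => inord (exponents [:: 0; 2; 0]%N i)].
have a0E i : a0 i = exponents [:: 0; 2; 0]%N i :> nat.
  by rewrite ffunE inordK//; case: i => -[|[|[|//]]].
rewrite (bigD1 a0) /=; last first.
  by rewrite (eq_bigr _ (fun i _ => a0E i)) !big_ord_recl big_ord0.
rewrite [X in _ + X]big1 ?addr0; last first.
  move=> a /andP[/eqP a2 aa0].
  rewrite scaled_quartic_mpartial ?a2//; case: ifP => [/forallP h|_]; last by rewrite !mul0r.
  by case/eqP: aa0; apply/ffunP => i; apply: val_inj; rewrite /= a0E (eqP (h i)).
rewrite scaled_quartic_mpartial; last first.
  by rewrite (eq_bigr _ (fun i _ => a0E i)) !big_ord_recl big_ord0.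
have -> : [forall i, exponents [:: 0; 2; 0]%N i == a0 i] by apply/forallP => i; rewrite a0E.
have -> : \prod_i X 0 i ^+ a0 i = X 0 i1 ^+ 2.
  rewrite (eq_bigr (fun i => X 0 i ^+ exponents [:: 0; 2; 0]%N i)) => [|i _]; last by rewrite a0E.
  rewrite !big_ord_recl big_ord0 /= /exponents /= /bump /=.
  have -> : lift ord0 ord0 = i1 by apply: val_inj.
  by rewrite !expr0 mul1r !mulr1.
set F := (\prod_i _)%:R.
have F0 : F != 0.
  by rewrite /F pnatr_eq0 -lt0n prodn_gt0// => i; exact: fact_gt0.
by rewrite mulrAC mulfK.
Qed.

Lemma caratheodory_metric_le : (caratheodory_metric G3 0 e2 <= (82 / 100 + 12 / 100 / 100 : R)%:E)%E.
Proof.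
apply: ge_ereal_sup => _ [f [hf _] <-].
by rewrite lee_fin; exact: derivative_e2_le.
Qed.

Definition quartic_speed : R := Num.sqrt (27 / 40).

Lemma quartic_speed_gt : 82 / 100 + 14 / 100 / 100 < quartic_speed.
Proof.
have p : 0 <= 82 / 100 + 14 / 100 / 100 :> R by lra.
by rewrite -[ltLHS]ger0_norm// -sqrtr_sqr ltr_sqrt; lra.
Qed.

(** The pseudonorm that separates the metrics. *)
Definition weight (X : V) : R := quartic_speed * normc (X 0 i1).

Lemma weight_pseudonorm : pseudonorm weight.
Proof.
have s0 : 0 <= quartic_speed by exact: sqrtr_ge0.
split=> [X Y|a X]; rewrite /weight mxE.
  by rewrite -mulrDr; apply: ler_wpM2l => //; exact: normcD_le.
by rewrite normcM mulrCA.
Qed.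

Lemma weight_e2 : weight e2 = quartic_speed.
Proof. by rewrite /weight; have [_ -> _] := vec3E (0 : C) 1 0; rewrite normc1 mulr1. Qed.

Lemma weight_sqr (X : V) : weight X ^+ 2 = 27 / 40 * normc (X 0 i1) ^+ 2.
Proof. by rewrite /weight exprMn sqr_sqrtr//; lra. Qed.

Lemma weight_ge0 (X : V) : 0 <= weight X.
Proof. by apply: mulr_ge0; [exact: sqrtr_ge0|exact: normc_ge0]. Qed.

Lemma weight_le_caratheodory2 (X : V) :
  ((weight X)%:E <= caratheodory_metric_k 2 G3 0 X)%E.
Proof.
apply: ereal_sup_ubound; exists scaled_quartic.
  by split; [exact: scaled_quartic_holo|exact: scaled_quartic_ord].
congr (_%:E); rewrite scaled_quartic_taylor_form powR12_sqrt ?normc_ge0//.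
rewrite normcM normcX normc_real ger0_norm; last by lra.
by rewrite -weight_sqr sqrtr_sqr ger0_norm ?weight_ge0.
Qed.

(** The speed bound for discs centred at 0; here 27/40 * 37/25 < 1. *)
Lemma weight_le_kobayashi (X : V) : ((weight X)%:E <= kobayashi_metric G3 0 X)%E.
Proof.
apply: le_ereal_inf_tmp => _ [a [phi [hphi phi0 <-]] <-].
have u0 : unit_disc (0 : C) by rewrite /unit_disc /mkset normc0 ltr01.
have dphi : differentiable phi 0 by exact: (hphi 0 u0).1.
have ph j : normc (phi 0 0 j) <= 0 by rewrite phi0 mxE normc0.
have := disc_speed_bound hphi ph ler01; rewrite mulr0 addr0 => hs.
rewrite lee_fin -ler_sqr ?nnegrE ?normc_ge0 ?weight_ge0// weight_sqr.
rewrite derive1E mxE derive_curve_coord; last exact: dphi.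
set D := 'D_1 (fun z : C => phi z 0 i1) 0 in hs *.
rewrite normcM exprMn mulrCA ler_piMr ?sqr_ge0//.
move: (normc D ^+ 2) hs => u; lra.
Qed.

Lemma pseudonorm_hull_ge (q : V -> R) (g : V -> \bar R) (X : V) : pseudonorm q ->
  (forall Y, ((q Y)%:E <= g Y)%E) -> ((q X)%:E <= pseudonorm_hull g X)%E.
Proof. by move=> hq qg; apply: ereal_sup_ubound; exists q. Qed.

Lemma caratheodory_metric_lt :
  (caratheodory_metric G3 0 e2 < caratheodory_metric_k_hat 2 G3 0 e2)%E /\
  (caratheodory_metric G3 0 e2 < kobayashi_buseman_metric G3 0 e2)%E.
Proof.
have lt : (caratheodory_metric G3 0 e2 < (weight e2)%:E)%E.
  apply: le_lt_trans caratheodory_metric_le _; rewrite lte_fin weight_e2.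
  by have := quartic_speed_gt; lra.
split; apply: lt_le_trans lt _; apply: pseudonorm_hull_ge weight_pseudonorm _ => Y.
  exact: weight_le_caratheodory2.
exact: weight_le_kobayashi.
Qed.

End Metrics.

(** * The Caratheodory distance near 0 *)

Section Distances.
Context {R : realType}.
Local Notation C := R[i].
Local Notation V := 'rV[C]_3.
Local Notation G3 := (@symm_tridisc R).
Local Notation e2 := (vec3 0 1 0 : V).

Lemma artanh_le (x : R) : 0 <= x < 1 -> artanh x <= x / (1 - x).
Proof.
move=> /andP[x0 x1]; rewrite /artanh ler_pdivrMr//.
have h : (1 + x) / (1 - x) = 1 + x / (1 - x) * 2 by field; lra.
rewrite h; apply: le_ln1Dx.
have : 0 <= x / (1 - x) by rewrite divr_ge0//; lra.
lra.
Qed.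

Lemma artanh_ge (x : R) : 0 <= x < 1 -> x / (1 + x) <= artanh x.
Proof.
move=> /andP[x0 x1]; rewrite /artanh ler_pdivlMr//.
have -> : (1 + x) / (1 - x) = ((1 - x) / (1 + x))^-1 by rewrite invf_div.
have p : 0 < (1 - x) / (1 + x) by rewrite divr_gt0//; lra.
rewrite lnV ?posrE//.
have h : (1 - x) / (1 + x) = 1 + - (x / (1 + x) * 2) by field; lra.
rewrite lerNr h; apply: le_ln1Dx; rewrite -subr_gt0.
by have -> : - (x / (1 + x) * 2) - -1 = (1 - x) / (1 + x) by field; lra.
Qed.

Definition moebius (a b : C) : C := (b - a) / (1 - conjc a * b).

Lemma moebius_den (a b : C) : unit_disc a -> unit_disc b -> 1 - conjc a * b != 0.
Proof.
move=> a1 b1; apply/eqP => /eqP; rewrite subr_eq0 => /eqP/(congr1 (@normc R)).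
rewrite normc1 normcM normc_conj => h.
have : normc a * normc b <= normc a * 1.
  by apply: ler_wpM2l; [exact: normc_ge0|exact: ltW].
by rewrite -h mulr1 => /le_lt_trans /(_ a1); rewrite ltxx.
Qed.

Lemma moebius_disc (a b : C) : unit_disc a -> unit_disc b -> unit_disc (moebius a b).
Proof.
move=> a1 b1; have den := moebius_den a1 b1.
have dp : 0 < normc (1 - conjc a * b).
  rewrite lt_neqAle normc_ge0 andbT eq_sym.
  by apply: contra den => /eqP/eq0_normc ->.
rewrite /unit_disc /mkset /moebius normcM normcV ltr_pdivrMr// mul1r.
rewrite -ltr_sqr ?nnegrE ?normc_ge0// -subr_gt0.
have -> : normc (1 - conjc a * b) ^+ 2 - normc (b - a) ^+ 2 =
    (1 - normc a ^+ 2) * (1 - normc b ^+ 2).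
  have cden : conjc (1 - conjc a * b) = 1 - a * conjc b.
    by rewrite rmorphB rmorph1 rmorphM /= conjcK.
  have cnum : conjc (b - a) = conjc b - conjc a by rewrite rmorphB.
  apply: complexI; rewrite rcM !rcB !normc_sqr_conj cden cnum.
  have -> : (1 : R)%:C = 1 by [].
  ring.
have sq (u : C) : unit_disc u -> 0 < 1 - normc u ^+ 2.
  by move=> u1; rewrite subr_gt0 expr_lt1// normc_ge0.
by rewrite mulr_gt0// sq.
Qed.

Lemma differentiable_moebius (a b : C) : unit_disc a -> unit_disc b ->
  differentiable (moebius a) b.
Proof.
move=> a1 b1; apply: differentiable_mul.
  by apply: differentiable_sub; [exact: differentiable_idC|exact: differentiable_const].
apply: differentiableV; last exact: moebius_den.
apply: differentiable_sub; first exact: differentiable_const.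
by apply: differentiable_mul; [exact: differentiable_const|exact: differentiable_idC].
Qed.

Lemma poincare_dist_moebius (a b : C) : poincare_dist a b = artanh (normc (moebius a b)).
Proof. by rewrite /poincare_dist /moebius !normcM [normc (a - b)]normc_dist. Qed.

Lemma symm_tridisc0 : G3 0.
Proof. by rewrite -vec3_0; apply: small_symm_tridisc; rewrite normc0; lra. Qed.

(** After a disc automorphism f(0) = 0.  Then the restriction of f to the line
    of e2 is f'(0)e2 t up to the second-order remainder, where 512 is
    32 / r^2 for r = 1/4. *)
Lemma poincare_dist_e2_le (f : V -> C) (t x : R) : holo G3 unit_disc f -> 0 < t <= 1 / 16 ->
  512 * t <= 1 / 100 / 100 ->
  x = t * (82 / 100 + 12 / 100 / 100 + 512 * t) ->
  poincare_dist (f 0) (f (vec3 0 t%:C 0)) <= x / (1 - x).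
Proof.
move=> hf /andP[t0 t16] t512 xE.
have f01 := (hf _ symm_tridisc0).2.
pose F := fun S => moebius (f 0) (f S).
have hF : holo G3 unit_disc F.
  move=> S GS; have [dfS fS] := hf S GS; split; last exact: moebius_disc.
  exact: (@differentiable_comp _ _ _ _ f (moebius (f 0)) S dfS (differentiable_moebius f01 fS)).
pose g (y : C) := F (vec3 0 y 0).
have Gy (y : C) : normc y <= 1 / 4 -> G3 (vec3 0 y 0).
  by move=> y4; apply: small_symm_tridisc; rewrite ?normc0//; lra.
have dg (y : C) : normc y <= 1 / 4 -> differentiable g y.
  move=> y4; apply: (@slice_differentiable R F (fun _ => 0) (fun y => y) (fun _ => 0) y hF).
  - exact: differentiable_const.
  - exact: differentiable_idC.
  - exact: differentiable_const.
  - exact: Gy.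
have g1 (y : C) : normc y <= 1 / 4 -> normc (g y) <= 1.
  by move=> y4; apply: ltW; exact: (hF _ (Gy y y4)).2.
have nt : normc t%:C = t by rewrite normc_real gtr0_norm.
have q4 : 0 < 1 / 4 :> R by lra.
have := @second_order_remainder R g (1 / 4) 1 q4 dg g1 t%:C.
rewrite nt => /(_ ltac:(lra)).
have g0 : g 0 = 0 by rewrite /g vec3_0 /F /moebius subrr mul0r.
have dg0 : normc ('D_1 g 0) <= 82 / 100 + 12 / 100 / 100.
  have dF0 : differentiable F 0 by exact: (hF _ symm_tridisc0).1.
  have -> : 'D_1 g 0 = 'd F 0 e2; last exact: derivative_e2_le.
  rewrite (diff_along _ dF0).
  have -> // : g = (fun w : C => F (w *: e2)).
  apply/funext => w; congr F.
  by apply/rowP => j; rewrite !mxE; case: j => -[|[|[|//]]] _ /=; rewrite ?mulr0 ?mulr1.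
move: ('D_1 g 0) dg0 => D hD; rewrite g0 subr0 => hr.
have gx : normc (g t%:C) <= x.
  move: hr.
  have := normcD_le (g t%:C - D * t%:C) (D * t%:C); rewrite subrK (normcM D) nt.
  have : normc D * t <= (82 / 100 + 12 / 100 / 100) * t by apply: ler_wpM2r => //; exact: ltW.
  have -> : 32 * 1 / (1 / 4) ^+ 2 = 512 :> R by field.
  rewrite xE; lra.
have x1 : x < 1 / 2.
  have : t * (82 / 100 + 12 / 100 / 100 + 512 * t) <= t * 1 by apply: ler_wpM2l; lra.
  rewrite xE; lra.
rewrite poincare_dist_moebius -/(F _) -/(g _).
have n0 := normc_ge0 (g t%:C).
apply: le_trans (artanh_le _) _; first by apply/andP; split; [exact: n0|lra].
rewrite ler_pdivrMr; last lra.
rewrite mulrAC ler_pdivlMr; last lra.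
lra.
Qed.

End Distances.

(** * The Kobayashi distance near 0 *)

Section Kobayashi.
Context {R : realType}.
Local Notation C := R[i].
Local Notation V := 'rV[C]_3.
Local Notation i0 := (0 : 'I_3).
Local Notation i1 := (1 : 'I_3).
Local Notation i2 := (2 : 'I_3).
Local Notation G3 := (@symm_tridisc R).

(** Strictly between the bound 0.8212 of [derivative_e2_le] and
    sqrt(25/37), the bound that [disc_speed_bound] gives at the origin. *)
Definition slope : R := 82 / 100 + 14 / 100 / 100.

(** A cone in the second coordinate, cut off in the other two by the small
    slope [dl]. *)
Definition tent (dl t : R) (S : V) : R :=
  Num.max 0 (slope * t - slope * normc (S 0 i1) - dl * normc (S 0 i0) - dl * normc (S 0 i2)).

Lemma tent_ge0 dl t S : 0 <= tent dl t S.
Proof. by rewrite /tent le_max lexx. Qed.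

Lemma tent_le dl t S : 0 <= dl -> 0 <= t -> tent dl t S <= slope * t.
Proof.
move=> dl0 t0; rewrite /tent ge_max; apply/andP; split.
  by apply: mulr_ge0 => //; rewrite /slope; lra.
have s0 : 0 <= slope by rewrite /slope; lra.
have := mulr_ge0 s0 (normc_ge0 (S 0 i1)); have := mulr_ge0 dl0 (normc_ge0 (S 0 i0)).
have := mulr_ge0 dl0 (normc_ge0 (S 0 i2)); lra.
Qed.

Lemma tent_lipschitz dl t (S T : V) : 0 <= dl ->
  `|tent dl t S - tent dl t T| <= slope * normc (S 0 i1 - T 0 i1)
    + dl * normc (S 0 i0 - T 0 i0) + dl * normc (S 0 i2 - T 0 i2).
Proof.
move=> dl0; wlog ST : S T / tent dl t T <= tent dl t S.
  move=> H; have [h|/ltW h] := leP (tent dl t T) (tent dl t S); first exact: H.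
  rewrite distrC [normc (S 0 i1 - _)]normc_dist [normc (S 0 i0 - _)]normc_dist.
  by rewrite [normc (S 0 i2 - _)]normc_dist; exact: H.
rewrite ger0_norm ?subr_ge0//.
have s0 : 0 <= slope by rewrite /slope; lra.
have l (k : R) (a b : C) : 0 <= k -> k * normc b - k * normc a <= k * normc (a - b).
  move=> k0; rewrite -mulrBr; apply: ler_wpM2l => //.
  by have := normcB_le a (a - b); rewrite opprB addrC subrK; lra.
have l0 (k : R) (a : C) : 0 <= k -> 0 <= k * normc a.
  by move=> k0; apply: mulr_ge0 => //; exact: normc_ge0.
have hT : slope * t - slope * normc (T 0 i1) - dl * normc (T 0 i0) - dl * normc (T 0 i2)
   <= tent dl t T by rewrite /tent le_max lexx orbT.
have := tent_ge0 dl t T.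
have := l slope (S 0 i1) (T 0 i1) s0; have := l dl (S 0 i0) (T 0 i0) dl0.
have := l dl (S 0 i2) (T 0 i2) dl0; have := l0 slope (S 0 i1 - T 0 i1) s0.
have := l0 dl (S 0 i0 - T 0 i0) dl0; have := l0 dl (S 0 i2 - T 0 i2) dl0.
move=> *; rewrite lerBlDr [tent dl t S]/tent ge_max; apply/andP; split; lra.
Qed.

Lemma tent_support dl t h (S : V) : 0 < dl -> 0 < t -> t <= dl * h -> dl <= 1 / 2 ->
  0 < tent dl t S -> forall j, normc (S 0 j) <= h.
Proof.
move=> dl0 t0 th dl1; rewrite /tent lt_max ltxx /= => pos.
have s0 : 0 < slope by rewrite /slope; lra.
have n0 := mulr_ge0 (ltW dl0) (normc_ge0 (S 0 i0)).
have n2 := mulr_ge0 (ltW dl0) (normc_ge0 (S 0 i2)).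
have n1 := mulr_ge0 (ltW s0) (normc_ge0 (S 0 i1)).
have st : slope * t <= t by rewrite ler_piMl ?(ltW t0)// /slope; lra.
have [e0 e1 e2] : [/\ normc (S 0 i0) <= h, normc (S 0 i1) <= h & normc (S 0 i2) <= h].
  split.
  - rewrite -(ler_pM2l dl0); lra.
  - have : dl * normc (S 0 i1) <= slope * normc (S 0 i1).
      by apply: ler_wpM2r; [exact: normc_ge0|rewrite /slope; lra].
    by move=> ?; rewrite -(ler_pM2l dl0); lra.
  - rewrite -(ler_pM2l dl0); lra.
by move=> -[[|[|[|//]]] hj]; [move: e0|move: e1|move: e2]; congr (normc (S 0 _) <= _); apply: val_inj.
Qed.

(** If |s| >= t, the height of the tent is enough.  Otherwise the tent
    vanishes at both ends, or both are within O(h) of 0; in that case the disc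
    has speed at most about sqrt(37/25) in the
    second coordinate by [disc_speed_bound], and slope * sqrt(37/25) is less
    than 1 by a margin that absorbs the cut-off terms and the second-order
    remainder. *)
Lemma tent_disc dl t h (phi : C -> V) (s : C) : 0 < dl -> 0 < t -> t <= dl * h ->
  48 * dl <= 2 / 100 / 100 -> 24 * t <= h -> 2 * 219 * h <= 3 / 100 / 100 ->
  holo unit_disc G3 phi -> unit_disc s ->
  `|tent dl t (phi 0) - tent dl t (phi s)| <= (1 - 1 / 100 / 100) * normc s.
Proof.
move=> dl0 t0 tdl dl48 t24 h219 hphi s1.
have n0 := normc_ge0 s.
have [st|st] := leP t (normc s).
  have b := (tent_ge0 dl t (phi 0), tent_ge0 dl t (phi s),
    tent_le (phi 0) (ltW dl0) (ltW t0), tent_le (phi s) (ltW dl0) (ltW t0)).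
  have : slope * t <= (1 - 1 / 100 / 100) * t.
    by apply: ler_wpM2r; [exact: ltW|rewrite /slope; lra].
  have : (1 - 1 / 100 / 100) * t <= (1 - 1 / 100 / 100) * normc s.
    by apply: ler_wpM2l; [lra|exact: st].
  by case: b => [[[b1 b2] b3] b4] u v; rewrite ler_norml; lra.
have u0 : unit_disc (0 : C) by rewrite /unit_disc /mkset normc0 ltr01.
have hr (z : C) : normc z <= 1 / 2 -> unit_disc z.
  by move=> z2; apply: (@le_lt_trans _ _ (1 / 2)) => //; lra.
have dj j (z : C) : normc z <= 1 / 2 -> differentiable (fun z : C => phi z 0 j) z.
  by move=> /hr z1; apply: differentiable_curve_coord; exact: (hphi z z1).1.
have bj j (z : C) : normc z <= 1 / 2 -> normc (phi z 0 j) <= 3.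
  by move=> /hr z1; apply: symm_tridisc_coord; exact: (hphi z z1).2.
have r2 : 0 < 1 / 2 :> R by lra.
have lipj j : normc (phi 0 0 j - phi s 0 j) <= 24 * normc s.
  have := @bounded_lipschitz R _ (1 / 2) 3 r2 (dj j) (bj j) 0 s.
  rewrite sub0r normc_opp normc0 => /(_ ltac:(lra) ltac:(lra)); lra.
have [P|] := boolP ((0 < tent dl t (phi 0)) || (0 < tent dl t (phi s))); last first.
  rewrite negb_or -!leNgt => /andP[z1 z2].
  have -> : tent dl t (phi 0) = 0 by apply/eqP; rewrite eq_le z1 tent_ge0.
  have -> : tent dl t (phi s) = 0 by apply/eqP; rewrite eq_le z2 tent_ge0.
  by rewrite subrr normr0; apply: mulr_ge0; [lra|exact: n0].
have dl12 : dl <= 1 / 2 by lra.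
have ph j : normc (phi 0 0 j) <= 2 * h.
  have h0 : 0 <= h by lra.
  case/orP: P => P.
    by have := tent_support dl0 t0 tdl dl12 P j; lra.
  have := tent_support dl0 t0 tdl dl12 P j; have := lipj j.
  have := normcD_le (phi 0 0 j - phi s 0 j) (phi s 0 j); rewrite subrK; lra.
have := disc_speed_bound hphi ph ltac:(lra).
have := @second_order_remainder R _ (1 / 2) 3 r2 (dj i1) (bj i1) s ltac:(lra).
move: ('D_1 (fun z : C => phi z 0 i1) 0) => v rem v2.
have sv : slope * normc v <= 1 - 6 / 100 / 100.
  have q0 : 0 <= 1 - 6 / 100 / 100 :> R by lra.
  have s0 : 0 <= slope by rewrite /slope; lra.
  rewrite -ler_sqr ?nnegrE//; last by rewrite mulr_ge0// normc_ge0.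
  rewrite exprMn.
  have : slope ^+ 2 * normc v ^+ 2 <= slope ^+ 2 * (37 / 25 + 3 / 100 / 100).
    by apply: ler_wpM2l; [exact: sqr_ge0|lra].
  rewrite /slope; lra.
have k384 : 32 * 3 / (1 / 2) ^+ 2 = 384 :> R by field.
rewrite k384 in rem.
have d1 : slope * normc (phi 0 0 i1 - phi s 0 i1) <= (1 - 5 / 100 / 100) * normc s.
  rewrite normc_dist.
  have := normcD_le (phi s 0 i1 - phi 0 0 i1 - v * s) (v * s).
  rewrite subrK normcM; move: rem sv n0 st t24 h219.
  move: (normc (phi s 0 i1 - phi 0 0 i1)) (normc (phi s 0 i1 - phi 0 0 i1 - v * s)).
  move: (normc v) (normc s) => w u; clear => q r rem sv u0 ut t24 h219 tri.
  have uu : 384 * u ^+ 2 <= 1 / 100 / 100 * u.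
    by rewrite expr2 mulrA; apply: ler_wpM2r; [exact: u0|lra].
  have s0 : 0 <= slope by rewrite /slope; lra.
  have sl1 : slope <= 1 by rewrite /slope; lra.
  have h1 : slope * q <= slope * (1 / 100 / 100 * u + w * u) by apply: ler_wpM2l => //; lra.
  have h2 : slope * w * u <= (1 - 6 / 100 / 100) * u.
    by apply: ler_wpM2r; [exact: u0|exact: sv].
  have e0 : 0 <= 1 / 100 / 100 * u by lra.
  by have := ler_piMl e0 sl1; lra.
have dd j : dl * normc (phi 0 0 j - phi s 0 j) <= 1 / 100 / 100 * normc s.
  apply: (@le_trans _ _ (dl * (24 * normc s))).
    by apply: ler_wpM2l; [exact: ltW|exact: lipj].
  by rewrite mulrA; apply: ler_wpM2r; [exact: n0|lra].
apply: le_trans (tent_lipschitz t _ _ (ltW dl0)) _.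
have := dd i0; have := dd i2; lra.
Qed.

(** Near 0 the margin 1/10000 of [tent_disc] compensates for
    artanh l >= l / (1 + l); for larger l the tent is too low to matter. *)
Lemma tent_le_artanh_lempert dl t h (x y : V) : 0 < dl -> 0 < t -> t <= dl * h ->
  48 * dl <= 2 / 100 / 100 -> 24 * t <= h -> 2 * 219 * h <= 3 / 100 / 100 ->
  (`|tent dl t x - tent dl t y|%:E <= artanhe (lempert G3 x y))%E.
Proof.
move=> dl0 t0 tdl dl48 t24 h219; set d := `|_|.
have d0 : 0 <= d by exact: normr_ge0.
have dt : d <= t.
  have st : slope * t <= t by rewrite ler_piMl ?(ltW t0)// /slope; lra.
  have b1 := (tent_ge0 dl t x, tent_ge0 dl t y).
  have b2 := (tent_le x (ltW dl0) (ltW t0), tent_le y (ltW dl0) (ltW t0)).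
  by case: b1 b2 => [u1 u2] [u3 u4]; rewrite /d ler_norml; lra.
have dlt1 : t <= 1 / 100 / 100 by lra.
have low : ((d / (1 - 1 / 100 / 100))%:E <= lempert G3 x y)%E.
  apply: le_ereal_inf_tmp => _ [a [a1 [phi [hphi phi0 phia]]] <-].
  rewrite lee_fin ler_pdivrMr; last lra.
  rewrite /d -phi0 -phia [leRHS]mulrC.
  exact: (tent_disc dl0 t0 tdl dl48 t24 h219 hphi a1).
rewrite /artanhe; case: ifPn => [l1|_]; last by rewrite leey.
move: (lempert G3 x y) low l1 => [l|//|//]; rewrite !(lee_fin, lte_fin) => low l1.
rewrite /=.
have l0 : 0 <= l.
  by apply: le_trans low; apply: divr_ge0; [exact: d0|lra].
apply: le_trans (artanh_ge _); last by rewrite l0 l1.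
rewrite ler_pdivlMr; last lra.
move: low; rewrite ler_pdivrMr; last lra.
move=> low.
have [l2|l2] := leP l (1 / 100 / 100).
  have : d * l <= d * (1 / 100 / 100) by apply: ler_wpM2l; [exact: d0|exact: l2].
  have : d * (1 / 100 / 100) <= l * (1 / 100 / 100) by apply: ler_wpM2r; lra.
  lra.
have : d * (1 + l) <= d * 2 by apply: ler_wpM2l; [exact: d0|lra].
lra.
Qed.

Lemma kobayashi_dist_neq_caratheodory :
  exists2 w, G3 w & kobayashi_dist G3 0 w <> caratheodory_dist G3 0 w.
Proof.
(* h is the size of the neighbourhood of 0 in use, dl the cut-off slope,
   t the height divided by the slope *)
pose h : R := 1 / 2 / 1000 / 1000; pose dl : R := 4 / 1000 / 1000; pose t := dl * h.
have h0 : 0 < h by rewrite /h; lra.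
have dl0 : 0 < dl by rewrite /dl; lra.
have t0 : 0 < t by exact: mulr_gt0.
have th : t <= dl * h by [].
have dl48 : 48 * dl <= 2 / 100 / 100 by rewrite /dl; lra.
have h219 : 2 * 219 * h <= 3 / 100 / 100 by rewrite /h; lra.
have t24 : 24 * t <= h.
  have : 24 * dl * h <= 1 * h by apply: ler_wpM2r; [exact: ltW|lra].
  rewrite /t; lra.
move: h dl t h0 dl0 t0 th dl48 h219 t24 => h dl t h0 dl0 t0 th dl48 h219 t24.
have nt : normc t%:C = t by rewrite normc_real gtr0_norm.
have t512 : 512 * t <= 1 / 100 / 100 by lra.
pose w : V := vec3 0 t%:C 0; have [w0 w1 w2] := vec3E (0 : C) t%:C 0.
exists w.
  by apply: small_symm_tridisc; rewrite ?normc0 ?nt; lra.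
pose x := t * (82 / 100 + 12 / 100 / 100 + 512 * t).
have low : ((slope * t)%:E <= kobayashi_dist G3 0 w)%E.
  apply: ereal_sup_ubound.
  exists (fun S T => `|tent dl t S - tent dl t T|).
    split.
      split=> [S _|S T _ _|S T U _ _ _]; first by rewrite subrr normr0.
        exact: distrC.
      exact: ler_distD.
    by move=> S T _ _; exact: (tent_le_artanh_lempert S T dl0 t0 th dl48 t24 h219).
  congr (_%:E); rewrite /tent w0 w1 w2 !mxE normc0 nt !mulr0 !subr0 subrr.
  have st : 0 <= slope * t by apply: mulr_ge0; [rewrite /slope; lra|exact: ltW].
  by rewrite maxxx subr0 (max_idPr st) ger0_norm.
have t16 : 0 < t <= 1 / 16 by apply/andP; split; lra.
have up : (caratheodory_dist G3 0 w <= (x / (1 - x))%:E)%E.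
  apply: ge_ereal_sup => _ [f hf <-]; rewrite lee_fin.
  exact: (poincare_dist_e2_le hf t16 t512 (erefl x)).
have lt : x / (1 - x) < slope * t.
  have x1 : x <= t.
    have : t * (82 / 100 + 12 / 100 / 100 + 512 * t) <= t * 1.
      by apply: ler_wpM2l; [exact: ltW|lra].
    rewrite mulr1; exact.
  rewrite ltr_pdivrMr; last by lra.
  have st : slope * (1 - t) <= slope * (1 - x).
    by apply: ler_wpM2l; [rewrite /slope; lra|lra].
  have : t * (82 / 100 + 12 / 100 / 100 + 512 * t) < t * (slope * (1 - t)).
    by rewrite ltr_pM2l// /slope; lra.
  have : t * (slope * (1 - t)) <= t * (slope * (1 - x)).
    by apply: ler_wpM2l; [exact: ltW|exact: st].
  rewrite -/x; lra.
move=> E; move: low; rewrite E => low.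
by have := le_trans low up; rewrite lee_fin leNgt lt.
Qed.

End Kobayashi.

Theorem theorem7p3 (R : realType) :
  let G3 : set 'rV[R[i]]_3 := symm_tridisc in
  let e2 : 'rV[R[i]]_3 := vec3 0 1 0 in
  [/\ (caratheodory_metric G3 0 e2 < caratheodory_metric_k_hat 2 G3 0 e2)%E,
      (caratheodory_metric G3 0 e2 < kobayashi_buseman_metric G3 0 e2)%E &
      exists2 w, G3 w & kobayashi_dist G3 0 w <> caratheodory_dist G3 0 w].
Proof.
move=> G3 e2; have [h1 h2] := @caratheodory_metric_lt R.
split; [exact: h1|exact: h2|exact: kobayashi_dist_neq_caratheodory].
Qed.
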